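(* For every loopless matroid $M$, the palindromic polynomials $\underline{H}_M(x)$ and $H_M(x)$ are $\gamma$-positive.
   Context: A polynomial $f(x)\in\mathbb{Z}[x]$ of degree $d$ with $f(x)=x^df(x^{-1})$ can be uniquely written as $f(x)=\sum_{i=0}^{\lfloor d/2\rfloor}\gamma_i x^i(1+x)^{d-2i}$ with $\gamma_i\in\mathbb{Z}$; $f$ is $\gamma$-positive if all $\gamma_i\ge0$. For a loopless matroid $M$ on $E$ (every singleton of rank $1$) with lattice of flats $\mathcal{L}(M)$: $\underline{\mathrm{CH}}(M)=\mathbb{Q}[x_F: F\in\mathcal{L}(M)\setminus\{\varnothing,E\}]/(I+J)$, $I$ generated by $x_{F_1}x_{F_2}$ for incomparable $F_1,F_2$, $J$ by $\sum_{F\ni i}x_F-\sum_{F\ni j}x_F$ for $i,j\in E$; and $\mathrm{CH}(M)=\mathbb{Q}[x_F,y_i: F\in\mathcal{L}(M)\setminus\{E\},\, i\in E]/(I'+J')$, $I'$ generated by $y_i-\sum_{F\not\ni i}x_F$, $J'$ by $x_{F_1}x_{F_2}$ for incomparable $F_1,F_2$ and $y_ix_F$ for $i\notin F$. All variables of degree $1$; $\underline{H}_M(x)=\sum_j\dim_{\mathbb{Q}}\underline{\mathrm{CH}}^j(M)x^j$ and $H_M(x)=\sum_j\dim_{\mathbb{Q}}\mathrm{CH}^j(M)x^j$; these are palindromic (of degrees $\mathrm{rk}(M)-1$ for $\mathrm{rk}(M)>0$, and $\mathrm{rk}(M)$, respectively). *)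

(* Defs.v *)
From HB Require Import structures.
From mathcomp Require Import all_boot all_order all_algebra.
From mathcomp Require Import mpoly.
Set Implicit Arguments. Unset Strict Implicit. Unset Printing Implicit Defensive.
Import Order.TTheory GRing.Theory Num.Theory.
Local Open Scope ring_scope.

Record matroid (E : finType) := Matroid {
  mrank : {set E} -> nat;
  mrank_card : forall A, (mrank A <= #|A|)%N;
  mrank_mono : forall A B : {set E}, A \subset B -> (mrank A <= mrank B)%N;
  mrank_submod : forall A B : {set E},
      (mrank (A :|: B) + mrank (A :&: B) <= mrank A + mrank B)%N }.

Definition flat (E : finType) (M : matroid E) (F : {set E}) : bool :=
  [forall e, (e \notin F) ==> (mrank M F < mrank M (e |: F))%N].

Definition loopless (E : finType) (M : matroid E) : Prop :=
  forall e : E, mrank M [set e] = 1%N.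

Definition incomparable (E : finType) (A B : {set E}) : bool :=
  ~~ (A \subset B) && ~~ (B \subset A).

Definition mvar (V : finType) (v : V) : {mpoly rat[#|V|]} := 'X_(enum_rank v).

Definition in_ideal n (G : {mpoly rat[n]} -> Prop) (p : {mpoly rat[n]}) : Prop :=
  exists s : seq ({mpoly rat[n]} * {mpoly rat[n]}),
    (forall q, q \in s -> G q.2) /\ p = \sum_(q <- s) q.1 * q.2.

Definition is_homog n (j : nat) (p : {mpoly rat[n]}) : bool :=
  all (fun m : 'X_{1..n} => mdeg m == j) (msupp p).

Definition quot_graded_dim n (G : {mpoly rat[n]} -> Prop) (j d : nat) : Prop :=
  exists b : 'I_d -> {mpoly rat[n]},
    [/\ forall k, is_homog j (b k),
        forall c : 'I_d -> rat,
          in_ideal G (\sum_(k < d) c k *: b k) -> forall k, c k = 0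
      & forall p, is_homog j p ->
          exists c : 'I_d -> rat, in_ideal G (p - \sum_(k < d) c k *: b k)].

Definition hilbert_fun n (G : {mpoly rat[n]} -> Prop) (h : nat -> nat) : Prop :=
  forall j, quot_graded_dim G j (h j).

Definition gamma_positive (f : {poly int}) : Prop :=
  exists gamma : nat -> int,
    (forall i, 0 <= gamma i) /\
    f = \sum_(i < ((size f).-1)./2.+1)
          (gamma i)%:P * 'X^i * (1 + 'X) ^+ ((size f).-1 - 2 * i)%N.

Definition hilbert_series_gamma_positive n (G : {mpoly rat[n]} -> Prop) : Prop :=
  (exists h, hilbert_fun G h) /\
  forall h, hilbert_fun G h ->
    exists f : {poly int}, (forall j, f`_j = (h j)%:Z) /\ gamma_positive f.

Section Chow.
Variables (E : finType) (M : matroid E).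

Definition redVar : finType := {F : {set E} | flat M F && (F != set0) && (F != setT)}.

Definition redChow_gens (p : {mpoly rat[#|redVar|]}) : Prop :=
  (exists F1 F2 : redVar, incomparable (val F1) (val F2) /\
      p = mvar F1 * mvar F2) \/
  (exists i j : E,
      p = \sum_(F : redVar | i \in val F) mvar F
          - \sum_(F : redVar | j \in val F) mvar F).

Definition flatVar : finType := {F : {set E} | flat M F && (F != setT)}.
Definition augVar : finType := (flatVar + E)%type.

Definition xa (F : flatVar) : {mpoly rat[#|augVar|]} := mvar (inl F : augVar).
Definition ya (i : E) : {mpoly rat[#|augVar|]} := mvar (inr i : augVar).

Definition augChow_gens (p : {mpoly rat[#|augVar|]}) : Prop :=
  (exists i : E, p = ya i - \sum_(F : flatVar | i \notin val F) xa F) \/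
  (exists F1 F2 : flatVar, incomparable (val F1) (val F2) /\
      p = xa F1 * xa F2) \/
  (exists (i : E) (F : flatVar), i \notin val F /\ p = ya i * xa F).

End Chow.

(* Main.v *)
(** Both rings are instances of one ring attached to a finite semimodular
    lattice: variables x_F with x_bot = 0, x_F x_G = 0 for incomparable F, G,
    and, writing sigma_K for the sum of the x_H over H >= K, the relations
    sigma_K = 0 for K covering the bottom and x_F sigma_K = 0 for K covering F.
    The lattice of flats gives the reduced Chow ring; the lattice of flats with
    a new bottom element adjoined below the empty flat gives the augmented one.

    The monomials x_{F1}^{a1} ... x_{Fk}^{ak} of Feichtner and Yuzvinsky, for
    chains F1 < ... < Fk with 0 < ai < rk F_i - rk F_{i-1}, form a basis of this
    ring.  They span because sigma_G^(rk G - rk F) vanishes after multiplication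
    by x_F when F < G.  They are independent because the ring has a degree
    functional, given recursively by
      deg_F (x_G^d m) = (-1)^(d-1) C(d-1, c-1) deg_G (tau^(d-c) m),
      c = rk G - rk F, tau = the sum of the x_H over H > G,
    for m supported above G, and the monomials with exponents ai replaced by
    c_i - ai are dual to the basis up to a triangular matrix.

    Hence the Hilbert series is a sum over chains of products of the polynomials
    x + ... + x^(c-1).  The edge labelling sending F < G to the smallest element
    of G \ F has exactly one rising maximal chain in every interval, so that the
    sum over chains becomes a sum over maximal chains, each weighted by a
    polynomial depending only on the descents of its label word: x (1+x)^(m-2)
    for every maximal rising run of length m but the last, and (1+x)^(m-1) for
    the last one.  Each product of these is 0 or x^k (1+x)^(d-2k). *)

Require Import Defs.
From mathcomp Require Import all_boot all_order all_algebra.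
From mathcomp Require Import ssrcomplements mpoly.
From mathcomp Require Import zify ring.
Set Implicit Arguments. Unset Strict Implicit. Unset Printing Implicit Defensive.
Import Order.TTheory GRing.Theory Num.Theory.
Local Open Scope ring_scope.

(** * Semimodular lattices with an edge labelling *)

Definition covers (T : finType) (le : rel T) (rk : T -> nat) (x y : T) : bool :=
  le x y && (rk y == (rk x).+1).

(** [lab x y] is meant for all [x < y], not only for covers: in the examples it is
    the smallest element of [y \ x], so that it is the smallest label of every
    maximal chain from [x] to [y]. *)
Record llattice (T : finType) := LLattice {
  lle : rel T;
  lbot : T;
  ltop : T;
  lrk : T -> nat;
  lab : T -> T -> nat;
  lle_refl : forall x, lle x x;
  lle_anti : forall x y, lle x y -> lle y x -> x = y;
  lle_trans : forall y x z, lle x y -> lle y z -> lle x z;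
  lle_bot : forall x, lle lbot x;
  lle_top : forall x, lle x ltop;
  lrk_lt : forall x y, lle x y -> x != y -> (lrk x < lrk y)%N;
  lab_split : forall x y z, lle x y -> x != y -> lle y z -> y != z ->
    lab x y != lab y z /\ lab x z = minn (lab x y) (lab y z);
  lab_cover : forall x y, lle x y -> x != y ->
    exists k, [/\ covers lle lrk x k, lle k y, lab x k = lab x y &
      forall k', covers lle lrk x k' -> lle k' y -> lab x k' = lab x y -> k' = k];
  lle_semimod : forall x a h, covers lle lrk x a -> lle x h -> ~~ lle a h ->
    exists2 k, covers lle lrk h k & forall z, lle k z = lle a z && lle h z }.

(** * Gamma expansions and weights of label words *)

Definition qnum (n : nat) : {poly int} := \sum_(i < n) 'X^i.
(** Generating function of the exponents that a basis monomial may carry on an element below the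
    top, for a rank jump n; [qnum n] plays this role for the top. *)
Definition qnum_mid (n : nat) : {poly int} := \sum_(i < n.-1) 'X^(i.+1).

(** The degree d of the expansion is a parameter, not read off the size as in [gamma_positive], so
    that the property holds for 0 and is closed under sums. *)
Definition gamma_nonneg (d : nat) (f : {poly int}) : Prop :=
  exists2 g : nat -> nat, True &
    f = \sum_(i < d./2.+1) (g i)%:R * 'X^i * (1 + 'X) ^+ (d - 2 * i)%N.

Lemma gamma_nonneg0 d : gamma_nonneg d 0.
Proof. by exists (fun=> 0%N) => //; rewrite big1 // => i _; rewrite !mul0r. Qed.

Lemma gamma_nonnegD d f g :
  gamma_nonneg d f -> gamma_nonneg d g -> gamma_nonneg d (f + g).
Proof.
move=> [a _ ->] [b _ ->]; exists (fun i => (a i + b i)%N) => //.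
by rewrite -big_split; apply: eq_bigr => i _; rewrite natrD !mulrDl.
Qed.

Lemma gamma_nonneg_sum d (I : finType) (P : pred I) (F : I -> {poly int}) :
  (forall i, P i -> gamma_nonneg d (F i)) -> gamma_nonneg d (\sum_(i | P i) F i).
Proof.
move=> h; elim/big_ind: _ => //; first exact: gamma_nonneg0.
exact: gamma_nonnegD.
Qed.

Lemma gamma_nonneg_monomial d k : (2 * k <= d)%N ->
  gamma_nonneg d ('X^k * (1 + 'X) ^+ (d - 2 * k)%N).
Proof.
move=> h; have hk : (k < d./2.+1)%N by lia.
exists (fun i => nat_of_bool (i == k)) => //.
rewrite (bigD1 (Ordinal hk)) //= eqxx mul1r big1 ?addr0 // => i.
by rewrite -val_eqE /= => /negPf ->; rewrite !mul0r.
Qed.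

Lemma qnum_midE n : qnum_mid n.+1 = qnum n.+1 - 1.
Proof. by rewrite /qnum_mid /qnum big_ord_recl /= expr0 addrC addKr. Qed.

Lemma qnum_shift n : 1 + 'X * qnum n = qnum n.+1.
Proof.
rewrite /qnum big_ord_recl expr0 mulr_sumr; congr (_ + _).
by apply: eq_bigr => i _; rewrite -exprS.
Qed.

(** This is [weight_cut] for a single rising run of m+1 letters, the first block having j+1 of them.
    From m to m+1 all old summands gain a factor 1+X, and [qnum_shift] accounts for the rest. *)
Lemma last_run_identity m :
  (1 + 'X) ^+ m = qnum m.+1 + \sum_(j < m) qnum_mid j.+1 * (1 + 'X) ^+ (m - j.+1)%N.
Proof.
elim: m => [|m IH]; first by rewrite big_ord0 addr0 /qnum big_ord1.
have -> : \sum_(j < m.+1) qnum_mid j.+1 * (1 + 'X) ^+ (m.+1 - j.+1)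
  = (1 + 'X) * \sum_(j < m) qnum_mid j.+1 * (1 + 'X) ^+ (m - j.+1) + qnum_mid m.+1.
  rewrite big_ord_recr /= subnn expr0 mulr1; congr (_ + _).
  rewrite mulr_sumr; apply: eq_bigr => j _.
  by rewrite mulrCA -exprS; congr (_ * _ ^+ _); have := ltn_ord j; lia.
have e : \sum_(j < m) qnum_mid j.+1 * (1 + 'X) ^+ (m - j.+1) = (1 + 'X) ^+ m - qnum m.+1.
  by rewrite [in RHS]IH addrAC subrr add0r.
rewrite e qnum_midE exprS -(qnum_shift m.+1); ring.
Qed.

(** The weight of a maximal rising run of m+1 letters that is followed by another run. A one-letter
    run of this kind makes the whole word weigh 0. *)
Definition run_weight (m : nat) : {poly int} :=
  if m is m'.+1 then 'X * (1 + 'X) ^+ m' else 0.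

(** The analogue of [last_run_identity] for a run with more letters behind it: a block filling the
    run is now weighed by [qnum_mid] as well. Pulling X out of the run weights reduces it to that
    identity. *)
Lemma run_identity m :
  run_weight m = qnum_mid m.+1 + \sum_(j < m) qnum_mid j.+1 * run_weight (m - j.+1)%N.
Proof.
elim: m => [|m IH]; first by rewrite big_ord0 addr0 /qnum_mid big_ord0.
rewrite big_ord_recr /= subnn mulr0 addr0.
rewrite (eq_bigr (fun j : 'I_m => 'X * (qnum_mid j.+1 * (1 + 'X) ^+ (m - j.+1)))); last first.
  move=> j _; have -> : (m.+1 - j.+1 = (m - j.+1).+1)%N by have := ltn_ord j; lia.
  by rewrite /= mulrCA.
rewrite -mulr_sumr.
have -> : \sum_(j < m) qnum_mid j.+1 * (1 + 'X) ^+ (m - j.+1) = (1 + 'X) ^+ m - qnum m.+1.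
  by rewrite [in RHS]last_run_identity addrAC subrr add0r.
rewrite qnum_midE -(qnum_shift m.+1); ring.
Qed.

(** Here [m.+1] is the length of the rising run that ends in the letter [e]. *)
Fixpoint word_weight (m e : nat) (u : seq nat) : {poly int} :=
  if u is e' :: u' then
    if (e < e')%N then word_weight m.+1 e' u' else run_weight m * word_weight 0 e' u'
  else (1 + 'X) ^+ m.

Definition weight (u : seq nat) : {poly int} :=
  if u is e :: u' then word_weight 0 e u' else 0.

(** The exponent k counts the descents. A closed run of m+1 letters contributes one X and m-1
    factors 1+X, which together account for m+1 units of the degree. *)
Lemma word_weight_gamma m e u :
  word_weight m e u = 0 \/
  exists2 k, (2 * k <= m + size u)%N &
    word_weight m e u = 'X^k * (1 + 'X) ^+ (m + size u - 2 * k)%N.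
Proof.
elim: u m e => [|e' u IH] m e /=.
  by right; exists 0%N; rewrite ?muln0 // addn0 subn0 mul1r.
case: ifP => _.
  by rewrite addnS -addSn; exact: IH.
case: m => [|m] /=; first by left; rewrite mul0r.
case: (IH 0%N e') => [->|[k hk ->]]; first by left; rewrite mulr0.
right; exists k.+1; first by move: hk; lia.
rewrite exprS mulrACA -exprD; congr (_ * _ ^+ _); move: hk; lia.
Qed.

Lemma weight_gamma u : gamma_nonneg (size u).-1 (weight u).
Proof.
case: u => [|e u] /=; first exact: gamma_nonneg0.
case: (word_weight_gamma 0 e u) => [->|[k hk ->]]; first exact: gamma_nonneg0.
by move: hk; rewrite add0n; exact: gamma_nonneg_monomial.
Qed.

(** The sum over the ways to cut off a rising prefix (whose first [m.+1] letters
    precede [u]) and to weigh it by [qnum_mid], or by [qnum] if nothing is left. *)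
Fixpoint cut_sum (m e : nat) (u : seq nat) : {poly int} :=
  if u is e' :: u' then
    qnum_mid m.+1 * word_weight 0 e' u' + (if (e < e')%N then cut_sum m.+1 e' u' else 0)
  else qnum m.+1.

(** The first cut falls either at or after the letter e, which is [cut_sum], or among the m letters
    of the run before e: then j+1 of them are cut off and m-(j+1) remain. A descent is handled by
    [run_identity], the end of the word by [last_run_identity]. *)
Lemma word_weight_cut m e u :
  word_weight m e u =
  cut_sum m e u + \sum_(j < m) qnum_mid j.+1 * word_weight (m - j.+1) e u.
Proof.
elim: u m e => [|e' u IH] m e /=; first exact: last_run_identity.
case: ifP => _; last first.
  rewrite addr0 [in LHS]run_identity mulrDl [X in _ + X]mulr_suml; congr (_ + _).
  by apply: eq_bigr => j _; rewrite mulrA.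
rewrite [LHS]IH big_ord_recr /= subnn [LHS]addrCA [LHS]addrC [X in X + _ = _]addrC.
congr (_ + _); last first.
  apply: eq_bigr => j _; congr (_ * _ ).
  by have -> : (m.+1 - j.+1 = (m - j.+1).+1)%N by have := ltn_ord j; lia.
Qed.

Lemma cut_sumE m e u :
  cut_sum m e u = (path ltn e u)%:R * qnum (m + size u).+1 +
    \sum_(i < size u) (path ltn e (take i u))%:R * (qnum_mid (m + i).+1 * weight (drop i u)).
Proof.
elim: u m e => [|e' u IH] m e /=; first by rewrite big_ord0 addr0 addn0 mul1r.
rewrite big_ord_recl /= addn0 mul1r addrCA; congr (_ + _).
case: (e < e')%N => /=; last by rewrite mul0r add0r big1 // => i _; rewrite mul0r.
rewrite IH addnS; congr (_ + _); apply: eq_bigr => i _ /=.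
by rewrite /bump /= add1n addnS.
Qed.

(** Word by word this mirrors the recursion of the Hilbert polynomial: the prefix cut off labels a
    chain up to the next element, and sortedness selects one chain for each such element. *)
Lemma weight_cut u : (0 < size u)%N ->
  weight u = (sorted ltn u)%:R * qnum (size u) +
    \sum_(i < (size u).-1) (sorted ltn (take i.+1 u))%:R *
       (qnum_mid i.+1 * weight (drop i.+1 u)).
Proof.
case: u => [//|e u] _ /=.
by rewrite word_weight_cut big_ord0 addr0 cut_sumE add0n.
Qed.

(** * Sums over maximal chains *)

Section ChainSums.
Variables (T : finType) (L : llattice T).
Implicit Types (x y z k : T) (u v : seq nat).
Local Notation le := (lle L).
Local Notation rk := (lrk L).
Local Notation cov := (covers (lle L) (lrk L)).

Lemma lrk_le x y : le x y -> (rk x <= rk y)%N.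
Proof.
by move=> h; have [->|/(lrk_lt h)/ltnW] := eqVneq x y.
Qed.

Lemma lrk_eq x y : le x y -> (rk y <= rk x)%N -> x = y.
Proof.
move=> h hr; apply/eqP/negPn/negP => /(lrk_lt h); lia.
Qed.

Lemma cov_le x k : cov x k -> le x k. Proof. by case/andP. Qed.
Lemma cov_rk x k : cov x k -> rk k = (rk x).+1. Proof. by case/andP=> _ /eqP. Qed.
Lemma cov_neq x k : cov x k -> x != k.
Proof. by move/cov_rk => h; apply/negP => /eqP e; move: h; rewrite e; lia. Qed.

(** Saturated chains are never stored: [f] is a continuation that receives the label word and the
    end point of each chain with n steps from x. *)
Fixpoint chain_sum n x (f : seq nat -> T -> {poly int}) : {poly int} :=
  if n is n'.+1 then \sum_(k | cov x k) chain_sum n' k (fun u y => f (lab L x k :: u) y)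
  else f [::] x.

Fixpoint reach x u y : bool :=
  if u is e :: u' then [exists k, [&& cov x k, lab L x k == e & reach k u' y]]
  else x == y.

Lemma chain_sum_eq n x f g :
  (forall u y, size u = n -> reach x u y -> f u y = g u y) ->
  chain_sum n x f = chain_sum n x g.
Proof.
elim: n x f g => [|n IH] x f g h /=; first by apply: h => /=.
apply: eq_bigr => k hk; apply: IH => u y hu hr; apply: h; rewrite /= ?hu //.
by apply/existsP; exists k; rewrite hk eqxx.
Qed.

Lemma chain_sum0 n x : chain_sum n x (fun _ _ => 0) = 0.
Proof. by elim: n x => [|n IH] x //=; rewrite big1. Qed.

Lemma chain_sumD n x f g :
  chain_sum n x (fun u y => f u y + g u y) = chain_sum n x f + chain_sum n x g.
Proof.
elim: n x f g => [//|n IH] x f g /=.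
by rewrite -big_split; apply: eq_bigr => k _; rewrite IH.
Qed.

Lemma chain_sumMl n x c f :
  chain_sum n x (fun u y => c * f u y) = c * chain_sum n x f.
Proof.
elim: n x f => [//|n IH] x f /=.
by rewrite mulr_sumr; apply: eq_bigr => k _; rewrite IH.
Qed.

Lemma chain_sum_sum n x (I : finType) (P : pred I) f :
  chain_sum n x (fun u y => \sum_(i | P i) f i u y) =
  \sum_(i | P i) chain_sum n x (f i).
Proof.
elim: n x f => [//|n IH] x f /=.
by rewrite exchange_big; apply: eq_bigr => k _; rewrite IH.
Qed.

Lemma chain_sum_cat i j x f :
  chain_sum (i + j) x f =
  chain_sum i x (fun u y => chain_sum j y (fun v z => f (u ++ v) z)).
Proof. by elim: i x f => [//|i IH] x f /=; apply: eq_bigr => k _; rewrite IH. Qed.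

Lemma chain_sum_gamma d n x f :
  (forall u y, size u = n -> gamma_nonneg d (f u y)) -> gamma_nonneg d (chain_sum n x f).
Proof.
elim: n x f => [|n IH] x f h /=; first exact: h.
by apply: gamma_nonneg_sum => k _; apply: IH => u y hu; apply: h => /=; rewrite hu.
Qed.

Lemma reach_le x u y : reach x u y -> le x y /\ rk y = (rk x + size u)%N.
Proof.
elim: u x => [|e u IH] x /=; first by move/eqP->; rewrite lle_refl addn0.
case/existsP=> k /and3P[hk _ /IH[hl hr]]; split; first exact: lle_trans (cov_le hk) hl.
by rewrite hr (cov_rk hk) addSnnS.
Qed.

(** Iterating [lab_split], the label of an interval is the minimum of the labels along any of its
    saturated chains. *)
Lemma reach_lab x u y : reach x u y -> x != y ->
  lab L x y \in u /\ all (leq (lab L x y)) u.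
Proof.
elim: u x => [|e u IH] x /=; first by move=> ->.
case/existsP=> k /and3P[hk /eqP <- hr] xy.
have [ky|ky] := eqVneq k y.
  have := reach_le hr; rewrite ky => -[_].
  rewrite inE -ky; case: u {IH hr} => [|? ?] /=; last by lia.
  by rewrite eqxx leqnn.
have [hin hall] := IH _ hr ky; have [hkl _] := reach_le hr.
have [_ ->] := lab_split (cov_le hk) (cov_neq hk) hkl ky.
rewrite inE geq_minl /=; split; last by apply: sub_all hall => a; lia.
case: (leqP (lab L x k) (lab L k y)) => _; rewrite ?eqxx // hin orbT //.
Qed.

(** A rising chain must begin with its smallest label, which is [lab L x y] by [reach_lab];
    [lab_cover] provides exactly one cover with this label. *)
Lemma rising_chain_unique x y : le x y ->
  chain_sum (rk y - rk x) x (fun u z => (sorted ltn u && (z == y))%:R) = 1.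
Proof.
move=> hxy; move en : (rk y - rk x)%N => n.
elim: n x hxy en => [|n IH] x hxy en /=.
  by rewrite (lrk_eq hxy) ?eqxx //; lia.
have nxy : x != y by apply/negP => /eqP exy; move: en; rewrite exy; lia.
have [k0 [hk0 hk0y hlab huniq]] := lab_cover hxy nxy.
(* Through any other cover the label [lab L x y] would have to occur after the first letter, against
   its minimality in a rising word. *)
rewrite (bigD1 k0) //= [X in _ + X]big1 ?addr0; last first.
  move=> k /andP[hk nk]; rewrite -[RHS](chain_sum0 n k).
  apply: chain_sum_eq => u z hu hr.
  case: (eqVneq z y) => [ezy|_]; last by rewrite andbF.
  subst z; rewrite andbT; case hs: (path ltn _ u) => //.
  case/negP: nk; apply/eqP; apply: huniq => //.
    by case: (reach_le hr).
  have hx : reach x (lab L x k :: u) y.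
    by apply/existsP; exists k; rewrite hk eqxx.
  have [hin /= /andP[hall _]] := reach_lab hx nxy.
  move: hin; rewrite inE => /orP[/eqP->//|hin].
  by move: hs; rewrite (path_sortedE ltn_trans) => /andP[/allP/(_ _ hin)/=]; lia.
have hk0r : (rk y - rk k0)%N = n by rewrite (cov_rk hk0); lia.
rewrite -[RHS](IH k0 hk0y hk0r); apply: chain_sum_eq => u z hu hr.
case: (eqVneq z y) => [ezy|_]; last by rewrite !andbF.
subst z; rewrite !andbT; congr (nat_of_bool _)%:R.
rewrite (path_sortedE ltn_trans); case: u hr hu => [//|e u] hr hu.
have nk0y : k0 != y.
  by apply/negP => /eqP ek; case: (reach_le hr) => _; rewrite ek /=; lia.
(* The remaining labels are at least [lab L k0 y], which differs from the minimum [lab L x k0] and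
   so exceeds it. *)
have [hne hmin] := lab_split (cov_le hk0) (cov_neq hk0) hk0y nk0y.
have [_ hall] := reach_lab hr nk0y.
rewrite (_ : all _ _ = true) //; apply: sub_all hall => a /=.
by rewrite hlab in hne hmin *; move: hne hmin; lia.
Qed.

Lemma chain_sum_rising n x (f : T -> {poly int}) :
  chain_sum n x (fun u y => (sorted ltn u)%:R * f y) =
  \sum_(y | le x y && (rk y == rk x + n)%N) f y.
Proof.
transitivity (chain_sum n x (fun u y => \sum_(z | le x z && (rk z == rk x + n)%N)
    f z * (sorted ltn u && (y == z))%:R)).
  apply: chain_sum_eq => u y hu /reach_le[hl hr].
  rewrite (bigD1 y) /=; last by rewrite hl hr hu eqxx.
  rewrite eqxx andbT mulrC big1 ?addr0 // => z /andP[_ /negPf nz].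
  by rewrite eq_sym nz andbF mulr0.
rewrite chain_sum_sum; apply: eq_bigr => z /andP[hl /eqP hr].
rewrite chain_sumMl; have := rising_chain_unique hl.
by rewrite hr addKn => ->; rewrite mulr1.
Qed.

Section Recursion.
Variable h : T -> {poly int}.
Hypothesis hE : forall x, x != ltop L ->
  h x = qnum (rk (ltop L) - rk x) +
    \sum_(y | [&& le x y, x != y & y != ltop L]) qnum_mid (rk y - rk x) * h y.

(** After [weight_cut], the rising prefixes of length i+1 collapse by [chain_sum_rising] to a sum
    over their end points, and the induction hypothesis rewrites the remaining chains. *)
Lemma chain_sum_expansion x : x != ltop L ->
  h x = chain_sum (rk (ltop L) - rk x) x (fun u _ => weight u).
Proof.
move en : (rk (ltop L) - rk x)%N => n.
elim/ltn_ind: n x en => n IH x en nx.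
have n_gt0 : (0 < n)%N by have := lrk_lt (lle_top L x) nx; lia.
rewrite (hE nx) en.
rewrite [RHS](@chain_sum_eq _ _ _ (fun u y => qnum n * ((sorted ltn u)%:R * 1) +
   \sum_(i < n.-1) qnum_mid i.+1 * ((sorted ltn (take i.+1 u))%:R * weight (drop i.+1 u)))); last first.
  move=> u y hu _; rewrite weight_cut hu // mulr1 mulrC; congr (_ + _).
  by apply: eq_bigr => i _; rewrite mulrCA.
rewrite chain_sumD chain_sumMl chain_sum_rising chain_sum_sum; congr (_ + _).
  rewrite (big_pred1 (ltop L)) ?mulr1 // => y.
  apply/andP/eqP => [[hl /eqP hr]|->]; last by rewrite lle_top; split=> //; apply/eqP; lia.
  apply: lrk_eq (lle_top _ _) _; lia.
(* Group by rank; the index is shifted by one since y lies strictly above x. The last class would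
   have the rank of the top and is empty. *)
rewrite (partition_big (fun y => inord (rk y - rk x).-1 : 'I_n.-1.+1) predT) //=.
have e : n = n.-1.+1 by lia.
rewrite big_ord_recr /= [X in _ + X]big1 ?addr0; last first.
  move=> y /andP[/and3P[hl ny nt] /eqP hv].
  have h1 := lrk_lt hl ny; have h2 := lrk_lt (lle_top L y) nt.
  by move: hv => /(congr1 val); rewrite /= inordK; lia.
apply: eq_bigr => i _.
have hi := ltn_ord i.
rewrite chain_sumMl.
rewrite -[X in chain_sum X x _](@subnKC i.+1 n); last by lia.
rewrite chain_sum_cat.
rewrite [X in _ * X](@chain_sum_eq _ _ _ (fun u y => (sorted ltn u)%:R *
    chain_sum (n - i.+1) y (fun v _ => weight v))); last first.
  move=> u y hu _; rewrite -chain_sumMl; apply: chain_sum_eq => v z _ _.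
  by rewrite -hu take_size_cat // drop_size_cat.
rewrite chain_sum_rising mulr_sumr; apply: eq_big => y.
  apply/andP/andP => [[/and3P[hl ny nt] /eqP hv]|[hl /eqP hr]].
    have h1 := lrk_lt hl ny; have h2 := lrk_lt (lle_top L y) nt.
    by move: hv => /(congr1 val) /=; rewrite inordK; last lia; split => //; apply/eqP; lia.
  split; last first.
    apply/eqP/val_inj => /=; rewrite inordK; lia.
  rewrite hl; apply/and3P; split=> //; apply/negP => /eqP ey; move: hr; rewrite -?ey; try lia.
  by rewrite ey; lia.
move=> /andP[/and3P[hl ny nt] /eqP hv].
have h1 := lrk_lt hl ny; have h2 := lrk_lt (lle_top L y) nt.
move: hv => /(congr1 val) /=; rewrite inordK; last lia.
move=> hv; have hr : (rk y - rk x = i.+1)%N by lia.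
rewrite hr (IH (n - i.+1)%N) //; lia.
Qed.

Lemma recursion_gamma x : x != ltop L ->
  gamma_nonneg (rk (ltop L) - rk x).-1 (h x).
Proof.
move=> nx; rewrite (chain_sum_expansion nx); apply: chain_sum_gamma => u _ <-.
exact: weight_gamma.
Qed.

End Recursion.
End ChainSums.

(** * The Chow ring of a lattice: spanning monomials *)

Section Ideals.
Variables (n : nat) (G : {mpoly rat[n]} -> Prop).
Implicit Types p q r : {mpoly rat[n]}.
Local Notation I := (in_ideal G).

Lemma in_ideal_gen p : G p -> I p.
Proof.
move=> gp; exists [:: (1, p)]; split; first by move=> q; rewrite inE => /eqP ->.
by rewrite big_seq1 mul1r.
Qed.

Lemma in_ideal0 : I 0.
Proof. by exists [::]; split => //; rewrite big_nil. Qed.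

Lemma in_idealD p q : I p -> I q -> I (p + q).
Proof.
move=> [s [hs ->]] [t [ht ->]]; exists (s ++ t); split; last by rewrite big_cat.
by move=> r; rewrite mem_cat => /orP[/hs|/ht].
Qed.

Lemma in_idealMl r p : I p -> I (r * p).
Proof.
move=> [s [hs ->]]; exists [seq (r * q.1, q.2) | q : _ * _ <- s]; split.
  by move=> q /mapP[q' /hs h ->].
by rewrite big_map mulr_sumr; apply: eq_bigr => q _; rewrite mulrA.
Qed.

Lemma in_idealMr r p : I p -> I (p * r).
Proof. by rewrite mulrC; exact: in_idealMl. Qed.

Lemma in_idealN p : I p -> I (- p).
Proof. by rewrite -mulN1r; exact: in_idealMl. Qed.

Lemma in_idealB p q : I p -> I q -> I (p - q).
Proof. by move=> hp hq; apply: in_idealD => //; apply: in_idealN. Qed.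

Lemma in_idealZ (a : rat) p : I p -> I (a *: p).
Proof. by rewrite -mul_mpolyC; exact: in_idealMl. Qed.

Lemma in_ideal_sum (J : Type) (s : seq J) (P : pred J) (F : J -> {mpoly rat[n]}) :
  (forall i, P i -> I (F i)) -> I (\sum_(i <- s | P i) F i).
Proof. by move=> h; elim/big_ind: _ => //; [exact: in_ideal0 | exact: in_idealD]. Qed.

(** The linear span of [Q] modulo the ideal, as an inductive closure: spanning arguments compose
    without coefficients, which are extracted only in [span_mod_seq]. *)
Inductive span_mod (Q : {mpoly rat[n]} -> Prop) : {mpoly rat[n]} -> Prop :=
| span_mod_ideal p : I p -> span_mod Q p
| span_mod_gen p : Q p -> span_mod Q p
| span_mod_add p q : span_mod Q p -> span_mod Q q -> span_mod Q (p + q)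
| span_mod_scale (a : rat) p : span_mod Q p -> span_mod Q (a *: p).

Lemma span_mod_sum Q (J : Type) (s : seq J) (P : pred J) (F : J -> {mpoly rat[n]}) :
  (forall i, P i -> span_mod Q (F i)) -> span_mod Q (\sum_(i <- s | P i) F i).
Proof.
move=> h; elim/big_ind: _ => //; last exact: span_mod_add.
exact: span_mod_ideal in_ideal0.
Qed.

Lemma span_mod_sub Q Q' p :
  (forall q, Q q -> span_mod Q' q) -> span_mod Q p -> span_mod Q' p.
Proof.
move=> h; elim=> {p} [p|p /h|p q _ hp _ hq|a p _ hp] //.
- exact: span_mod_ideal.
- exact: span_mod_add.
- exact: span_mod_scale.
Qed.

Lemma span_mod_seq (s : seq {mpoly rat[n]}) p :
  span_mod (fun q => q \in s) p ->
  exists c : 'I_(size s) -> rat, I (p - \sum_(k < size s) c k *: s`_k).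
Proof.
elim=> {p} [p hp|p hp|p q _ [c hc] _ [d hd]|a p _ [c hc]].
- by exists (fun=> 0); rewrite big1 ?subr0 // => k _; rewrite scale0r.
- have hk : (index p s < size s)%N by rewrite index_mem.
  exists (fun k => (k == Ordinal hk)%:R).
  rewrite (bigD1 (Ordinal hk)) //= eqxx scale1r big1 ?addr0 ?nth_index ?subrr //.
    exact: in_ideal0.
  by move=> k /negPf ->; rewrite scale0r.
- exists (fun k => c k + d k); rewrite (eq_bigr _ (fun k _ => scalerDl _ _ _)).
  by rewrite big_split opprD addrACA; exact: in_idealD.
- exists (fun k => a * c k); rewrite (eq_bigr _ (fun k _ => esym (scalerA _ _ _))).
  by rewrite -scaler_sumr -scalerBr; exact: in_idealZ.
Qed.

End Ideals.

Section LatticeChow.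
Variables (T : finType) (L : llattice T).
Implicit Types (x y z g h k : T) (s : seq T).
Local Notation le := (lle L).
Local Notation rk := (lrk L).
Local Notation cov := (covers (lle L) (lrk L)).
Local Notation bot := (lbot L).
Local Notation top := (ltop L).
Local Notation R := {mpoly rat[#|T|]}.
Local Notation X := (@mvar T).

Definition llt x y := le x y && (x != y).

Lemma llt_le x y : llt x y -> le x y. Proof. by case/andP. Qed.

Lemma llt_rk x y : llt x y -> (rk x < rk y)%N.
Proof. by case/andP => *; apply: lrk_lt. Qed.

Lemma llt_le_trans y x z : llt x y -> le y z -> llt x z.
Proof.
move=> /andP[xy nxy] yz; rewrite /llt (lle_trans xy yz); apply/negP => /eqP e.
by case/negP: nxy; apply/eqP; apply: (@lle_anti _ L) => //; rewrite e.
Qed.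

Lemma le_llt_trans y x z : le x y -> llt y z -> llt x z.
Proof.
move=> xy /andP[yz nyz]; rewrite /llt (lle_trans xy yz); apply/negP => /eqP e.
by case/negP: nyz; apply/eqP; apply: (@lle_anti _ L) => //; rewrite -e.
Qed.

Lemma llt_trans y x z : llt x y -> llt y z -> llt x z.
Proof. by move=> xy /llt_le; apply: llt_le_trans. Qed.

Lemma llt_top x : x != top -> llt x top.
Proof. by rewrite /llt lle_top => ->. Qed.

Lemma top_llt x : llt top x = false.
Proof.
apply/negP => /andP[h /eqP []]; apply: (@lle_anti _ L) => //; exact: lle_top.
Qed.

Lemma llt_neq_top x y : llt x y -> x != top.
Proof. by move=> h; apply/negP => /eqP e; move: h; rewrite e top_llt. Qed.

Lemma cov_llt x k : cov x k -> llt x k.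
Proof. by move=> h; rewrite /llt (cov_le h) (cov_neq h). Qed.

(** The axioms give covers of the lower end of an interval; climbing along these from x yields an
    element covered by y. *)
Lemma lower_cover x y : llt x y -> exists2 z, le x z & cov z y.
Proof.
move en : (rk y - rk x)%N => n; elim: n x en => [|n IH] x en h.
  by have := llt_rk h; lia.
have /andP[hl hn] := h.
have [k [hk hky _ _]] := lab_cover hl hn.
have [e|nk] := eqVneq k y; first by exists x; [exact: lle_refl | rewrite -e].
have [||z hz hzy] := IH k; first by rewrite (cov_rk hk); lia.
  by rewrite /llt hky nk.
by exists z => //; apply: lle_trans (cov_le hk) hz.
Qed.

Definition sigma k : R := \sum_(h | le k h) X h.
Definition sigma' k : R := \sum_(h | llt k h) X h.

Lemma sigmaE k : sigma k = X k + sigma' k.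
Proof. by rewrite /sigma (bigD1 k) ?lle_refl //; congr (_ + _); apply: eq_bigl => h; rewrite /llt eq_sym. Qed.

Definition lchow_gens (p : R) : Prop :=
  [\/ p = X bot,
      exists x y, [/\ ~~ le x y, ~~ le y x & p = X x * X y],
      exists2 k, cov bot k & p = sigma k |
      exists x k, cov x k /\ p = X x * sigma k].

Local Notation I := (in_ideal lchow_gens).

Lemma ideal_bot : I (X bot).
Proof. by apply: in_ideal_gen; apply: Or41. Qed.

Lemma ideal_incomparable x y : ~~ le x y -> ~~ le y x -> I (X x * X y).
Proof. by move=> *; apply: in_ideal_gen; apply: Or42; exists x, y. Qed.

Lemma ideal_atom k : cov bot k -> I (sigma k).
Proof. by move=> *; apply: in_ideal_gen; apply: Or43; exists k. Qed.

Lemma ideal_cover x k : cov x k -> I (X x * sigma k).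
Proof. by move=> *; apply: in_ideal_gen; apply: Or44; exists x, k. Qed.

(** Modulo incomparable products, [X h * sigma g = X h * sigma (h \/ g)], and by
    semimodularity the join [h \/ g] covers [h]. *)
Lemma ideal_mul_sigma z g h : cov z g -> le z h -> ~~ le g h -> I (X h * sigma g).
Proof.
move=> hzg hzh ngh; have [k hk hkE] := lle_semimod hzg hzh ngh.
rewrite /sigma (bigID (le h)) /= mulrDr; apply: in_idealD.
  have -> : \sum_(i | le g i && le h i) X i = sigma k.
    by apply: eq_bigl => i; rewrite hkE.
  exact: ideal_cover.
rewrite mulr_sumr; apply: in_ideal_sum => i /andP[gi hi].
apply: ideal_incomparable => //; apply: contra ngh; exact: lle_trans.
Qed.

(** What [sigma_nilpotent] needs of a multiplier: it holds for 1 at the bottom and for multiples of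
    [X x], so the spanning induction can carry along the part of the monomial already in normal
    form. *)
Definition kills_covers x (y : R) := forall k, cov x k -> I (y * sigma k).

(** Induction on the rank of g, with z covered by g. By [ideal_mul_sigma], sigma_g (sigma_z -
    sigma_g) lies in the ideal, so sigma_g^(n+1) may be replaced by sigma_g sigma_z^n. *)
Lemma sigma_nilpotent x (y : R) g : kills_covers x y -> llt x g ->
  I (y * sigma g ^+ (rk g - rk x)).
Proof.
move=> hy; move en : (rk g - rk x)%N => n; elim: n g en => [|n IH] g en hg.
  by have := llt_rk hg; lia.
have [z hxz hzg] := lower_cover hg.
have [exz|nxz] := eqVneq x z.
  subst z; move: en; rewrite (cov_rk hzg) subSnn => -[<-].
  by rewrite expr1; apply: hy.
have hz : I (y * sigma z ^+ n).
  by apply: IH; [move: en; rewrite (cov_rk hzg); have := lrk_le hxz; lia | rewrite /llt hxz].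
have hd : I (sigma g * (sigma z - sigma g)).
  have -> : sigma z - sigma g = \sum_(h | le z h && ~~ le g h) X h.
    rewrite /sigma [X in X - _](bigID (le g)) /= addrAC.
    rewrite (eq_bigl (le g)) ?subrr ?add0r // => h.
    by apply/andP/idP => [[]//|gh]; split=> //; apply: lle_trans (cov_le hzg) gh.
  rewrite mulr_sumr; apply: in_ideal_sum => h /andP[zh gh]; rewrite mulrC.
  exact: ideal_mul_sigma zh gh.
have -> : y * sigma g ^+ n.+1 =
    sigma g * (y * sigma z ^+ n) - y * (sigma g * (sigma z ^+ n - sigma g ^+ n)).
  by rewrite exprS; ring.
apply: in_idealB; first exact: in_idealMl.
by apply: in_idealMl; rewrite subrXX mulrA; apply: in_idealMr.
Qed.

(** A basis monomial is a word of pairs (flat, exponent) along a chain.  The last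
    letter is always a power of the top variable, possibly with exponent 0. *)
Definition word := seq (T * nat).
Definition wdeg (w : word) : nat := sumn [seq p.2 | p <- w].
Definition wmon (w : word) : R := \prod_(p <- w) X p.1 ^+ p.2.

Definition heads x : seq (T * nat) :=
  [seq (y, a.+1) | y <- enum [pred y | llt x y && (y != top)], a <- iota 0 (rk y - rk x).-1].

Definition tops x : seq word := [seq [:: (top, b)] | b <- iota 0 (rk top - rk x)].

(** The fuel bounds the corank of x; [fyE] is the recursion without it. *)
Fixpoint fy_fuel n x : seq word :=
  tops x ++ (if n is n'.+1 then [seq p :: w | p <- heads x, w <- fy_fuel n' p.1] else [::]).

Definition fy x : seq word := fy_fuel (rk top - rk x) x.

Lemma headsP x p :
  reflect [/\ llt x p.1, p.1 != top & (0 < p.2 < rk p.1 - rk x)%N] (p \in heads x).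
Proof.
apply: (iffP allpairsPdep) => [[y [a [hy ha ->]]]|[h1 h2 h3]] /=.
  move: hy ha; rewrite mem_enum mem_iota => /andP[hy ny] ha; split => //; move: ha; clear; lia.
exists p.1, p.2.-1; split; first by rewrite mem_enum inE h1.
  by rewrite mem_iota; lia.
by case: p {h1 h2} h3 => p1 [|p2].
Qed.

Lemma heads_nil x : (rk top - rk x)%N = 0%N -> heads x = [::].
Proof.
move=> h0; case E : (heads x) => [//|[g a] s].
have : (g, a) \in heads x by rewrite E mem_head.
by case/headsP => /= /llt_rk; have := lrk_le (lle_top L g); lia.
Qed.

Lemma fy_fuelE n m x : (rk top - rk x <= n)%N -> (rk top - rk x <= m)%N ->
  fy_fuel n x = fy_fuel m x.
Proof.
elim: n m x => [|n IH] [|m] x //= hn hm; rewrite ?cats0.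
- by rewrite heads_nil ?cats0 //; lia.
- by rewrite heads_nil ?cats0 //; lia.
congr (_ ++ flatten _); apply/eq_in_map => -[g a] /headsP[/= /llt_rk h _ _].
by rewrite (IH m g) //; lia.
Qed.

Lemma fyE x : fy x = tops x ++ [seq p :: w | p <- heads x, w <- fy p.1].
Proof.
rewrite /fy; case en : (rk top - rk x)%N => [|n].
  by rewrite heads_nil /= ?cats0.
rewrite /=; congr (_ ++ flatten _); apply/eq_in_map => -[g a] /headsP[/= /llt_rk h _ _].
by rewrite (@fy_fuelE n (rk top - rk g)) //; lia.
Qed.

Lemma fy_cons x p w : p \in heads x -> w \in fy p.1 -> p :: w \in fy x.
Proof.
by move=> hp hw; rewrite fyE mem_cat; apply/orP; right; apply/allpairsPdep; exists p, w.
Qed.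

Lemma fy_top x b : (b < rk top - rk x)%N -> [:: (top, b)] \in fy x.
Proof.
move=> hb; rewrite fyE mem_cat; apply/orP; left; apply/mapP; exists b => //.
by rewrite mem_iota.
Qed.

Definition xprod s : R := \prod_(h <- s) X h.

(** An element g of least rank in s is below all the others, or incomparable to one of them, which
    puts the product into the ideal. *)
Lemma xprod_decomp x s : all (llt x) s ->
  [\/ s = [::], I (xprod s) |
    exists g d s', [/\ llt x g, (0 < d)%N, all (llt g) s' & perm_eq s (nseq d g ++ s')]].
Proof.
case: s => [|h0 s0]; first by move=> _; apply: Or31.
move es : (h0 :: s0) => s hs.
have h0s : h0 \in s by rewrite -es mem_head.
have [g gs gmin] := arg_minnP rk (h0s : (fun i => i \in s) h0).
case/boolP: (all (le g) s) => [hall|/allPn[h hin ngh]].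
  apply: Or33; exists g, (count_mem g s), [seq h <- s | h != g]; split.
  - exact: (allP hs).
  - by rewrite -has_count; apply/hasP; exists g => //=.
  - apply/allP => h; rewrite mem_filter => /andP[nh hin].
    by rewrite /llt (allP hall _ hin) eq_sym.
  - rewrite -(perm_filterC (pred1 g) s) perm_cat2r.
    have -> : count_mem g s = size (filter (pred1 g) s) by rewrite size_filter.
    by rewrite (all_pred1P _ _ (filter_all (pred1 g) s)) size_nseq perm_refl.
apply: Or32; rewrite /xprod (big_rem g) //= (big_rem h) /=; last first.
  by rewrite (rem_mem _ hin) //; apply: contra ngh => /eqP ->; exact: lle_refl.
rewrite mulrA; apply: in_idealMr; apply: ideal_incomparable => //.
apply: contra ngh => hg; have := gmin h hin => /(lrk_eq hg) ->; exact: lle_refl.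
Qed.

Definition fy_span x (y : R) j q :=
  exists2 w, w \in fy x & wdeg w = j /\ q = y * wmon w.

Lemma span_sigma' Q (c : R) g (m : nat) s : all (llt g) s ->
  (forall s', all (llt g) s' -> size s' = (m + size s)%N -> span_mod lchow_gens Q (c * xprod s')) ->
  span_mod lchow_gens Q (c * (sigma' g ^+ m * xprod s)).
Proof.
elim: m s => [|m IH] s hs h; first by rewrite mul1r; apply: h.
rewrite exprSr -mulrA mulr_suml mulr_sumr mulr_sumr; apply: span_mod_sum => i hi.
have -> : X i * xprod s = xprod (i :: s) by rewrite /xprod big_cons.
apply: IH => [/=|s' hs' hsz]; first by rewrite hi.
by apply: h => //; rewrite hsz /= addnS addSn.
Qed.

(** Straightening, by induction on the corank of x, then on that of the least factor g, then on its
    exponent d. An exponent that is too large is lowered by means of sigma_g^c = 0, in exchange for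
    factors above g. *)
Lemma xprod_span x (y : R) s : x != top -> kills_covers x y -> all (llt x) s ->
  span_mod lchow_gens (fy_span x y (size s)) (y * xprod s).
Proof.
move en : (rk top - rk x)%N => n.
elim/ltn_ind: n x en y s => n IHx x en y s nx hy.
have ltx := llt_rk (llt_top nx).
(* A product of variables above g may be assumed to be a power of some g' times variables above
   g'. *)
have reduce g j :
    (forall g' d' s', llt g g' -> all (llt g') s' -> (d' + size s')%N = j ->
       span_mod lchow_gens (fy_span x y j) (y * (X g' ^+ d' * xprod s'))) ->
    forall s, all (llt g) s -> size s = j -> span_mod lchow_gens (fy_span x y j) (y * xprod s).
  move=> IH t ht hj; case: (xprod_decomp ht) => [e|hI|[g' [d [s' [hg' _ hs' hp]]]]].
  - apply: span_mod_gen; exists [:: (top, 0%N)]; first by apply: fy_top; lia.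
    by rewrite -hj e /wmon big_seq1 /xprod big_nil.
  - by apply: span_mod_ideal; apply: in_idealMl.
  - rewrite /xprod (perm_big _ hp) big_cat /= big_nseq -/(xprod _).
    have -> : iter d ( *%R (X g')) 1 = X g' ^+ d.
      by rewrite -[RHS]mulr1; elim: (d) => [|d' /= ->]; rewrite ?mul1r // exprS mulrA.
    by apply: IH => //; rewrite -hj (perm_size hp) size_cat size_nseq.
have main : forall g d t, llt x g -> all (llt g) t ->
    span_mod lchow_gens (fy_span x y (d + size t)) (y * (X g ^+ d * xprod t)).
  move=> g; move em : (rk top - rk g)%N => m.
  elim/ltn_ind: m g em => m IHg g em d.
  elim/ltn_ind: d => d IHd t hg ht.
  have [d0|d_gt0] := posnP d.
    rewrite d0 mul1r add0n; apply: (reduce g) => // g' d' s' hg' hs' <-.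
    apply: (IHg (rk top - rk g')%N) => //.
      by have := llt_rk hg'; have := lrk_le (lle_top L g'); lia.
    exact: llt_trans hg hg'.
  have [etop|ntop] := eqVneq g top.
    subst g; case: t ht => [_|h t] /=; last by rewrite top_llt.
    rewrite /xprod big_nil mulr1 addn0; case: (ltnP d (rk top - rk x)) => hd.
      apply: span_mod_gen; exists [:: (top, d)]; first exact: fy_top.
      by rewrite /wdeg /wmon big_seq1 /= addn0.
    apply: span_mod_ideal; rewrite -(subnKC hd) exprD mulrA; apply: in_idealMr.
    have {1}-> : X top = sigma top.
      by rewrite sigmaE /sigma' big_pred0 ?addr0 // => h; rewrite top_llt.
    exact: sigma_nilpotent.
  case: (ltnP d (rk g - rk x)) => hd.
    (* The exponent is admissible: y X_g^d is the multiplier for the induction at g, and (g, d) is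
       put in front of the words obtained there. *)
    have hk : kills_covers g (y * X g ^+ d).
      move=> k hk; rewrite -mulrA; apply: in_idealMl; rewrite -(ltn_predK d_gt0) exprS mulrAC.
      by apply: in_idealMr; apply: ideal_cover.
    have hlt : (rk top - rk g < n)%N.
      by have := llt_rk hg; have := lrk_le (lle_top L g); lia.
    have := IHx _ hlt g erefl _ t ntop hk ht.
    rewrite -mulrA => /span_mod_sub; apply.
    move=> q [w hw [<- ->]]; apply: span_mod_gen; exists ((g, d) :: w).
      by apply: fy_cons => //; apply/headsP; rewrite /= hg ntop d_gt0 hd.
    by split=> //; rewrite /wmon big_cons mulrA.
  (* The exponent is too large: expanding (X_g + sigma'_g)^c expresses y X_g^c through terms with a
     smaller power of X_g. *)
  have hS := sigma_nilpotent hy hg.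
  set c := (rk g - rk x)%N in hd hS.
  rewrite sigmaE exprDn big_ord_recl subn0 expr0 mulr1 bin0 mulr1n mulrDr in hS.
  set S := \sum_(i < c) _ in hS.
  have -> : y * (X g ^+ d * xprod t) =
      X g ^+ (d - c) * xprod t * (y * X g ^+ c + y * S) + -1 *: (y * (X g ^+ (d - c) * xprod t * S)).
    rewrite scaleN1r -[in LHS](subnK hd) exprD; ring.
  apply: span_mod_add; first by apply: span_mod_ideal; apply: in_idealMl.
  apply: span_mod_scale; rewrite !mulr_sumr; apply: span_mod_sum => i _ /=.
  have hi := ltn_ord i.
  have -> : y * (X g ^+ (d - c) * xprod t * (X g ^+ (c - bump 0 i) * sigma' g ^+ bump 0 i *+ 'C(c, bump 0 i)))
     = ('C(c, bump 0 i))%:R *: (y * X g ^+ (d - i.+1) * (sigma' g ^+ i.+1 * xprod t)).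
    rewrite /bump /= add1n scaler_nat -!mulrnAr.
    have -> : (d - i.+1 = (d - c) + (c - i.+1))%N by lia.
    rewrite exprD; ring.
  apply: span_mod_scale; apply: span_sigma' => // s' hs' hsz.
  rewrite -mulrA; have -> : (d + size t = (d - i.+1) + size s')%N by lia.
  by apply: IHd => //; lia.
move=> hs; apply: (reduce x) => // g d t hg ht <-; exact: main.
Qed.
End LatticeChow.

(** * The degree functional *)

Section DegreeFunctional.
Variables (T : finType) (L : llattice T).
Implicit Types (x y z g h k : T) (m e : 'X_{1..#|T|}).
Local Notation le := (lle L).
Local Notation lt := (llt L).
Local Notation rk := (lrk L).
Local Notation cov := (covers (lle L) (lrk L)).
Local Notation bot := (lbot L).
Local Notation top := (ltop L).
Local Notation R := {mpoly rat[#|T|]}.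
Local Notation X := (@mvar T).
Local Notation "m \at h" := (fun_of_multinom m (enum_rank h)) (at level 20).

Definition mone h : 'X_{1..#|T|} := U_(enum_rank h)%MM.

Lemma mone_at g h : mone g \at h = (g == h).
Proof. by rewrite mnm1E (inj_eq enum_rank_inj). Qed.

Definition at_simpl := (@mnmDE #|T|, @mulmnE #|T|, mone_at, @mnm0E #|T|, @mnmBE #|T|).

Lemma mnm_eq_at m m' : (forall h, m \at h = m' \at h) -> m = m'.
Proof. by move=> hm; apply/mnmP => i; rewrite -(enum_valK i). Qed.

Definition min_supp m : option T :=
  [pick g | (0 < m \at g)%N && [forall h, (0 < m \at h)%N ==> le g h]].

Definition supp_above x m : Prop := forall h, (0 < m \at h)%N -> lt x h.

(** The linear extension of [f] evaluated at tau^n times the monomial m, where tau is the sum of the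
    variables above g. *)
Fixpoint dsum (f : 'X_{1..#|T|} -> rat) g n m : rat :=
  if n is n'.+1 then \sum_(h | lt g h) dsum f g n' (m + mone h)%MM else f m.

(** [deg_fuel n] is the functional of the header as soon as [n >= rk top - rk x].
    The top variable plays a special role: [deg_F (X_top^d)] is [(-1)^(c-1)] for
    [d = c-1], where [c = rk top - rk F], and 0 otherwise. *)
Fixpoint deg_fuel n x m : rat :=
  if m == 0%MM then (-1) ^+ (rk top - rk x).-1 * ((rk top - rk x).-1 == 0%N)%:R else
  if min_supp m is Some g then
    if ~~ lt x g then 0 else
    if g == top then (-1) ^+ (rk top - rk x).-1 * (m \at top == (rk top - rk x).-1)%:R else
    if n isn't n'.+1 then 0 else
    if (rk g - rk x <= m \at g)%N then
      (-1) ^+ (m \at g).-1 * 'C((m \at g).-1, (rk g - rk x).-1)%:R *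
      dsum (deg_fuel n' g) g (m \at g - (rk g - rk x)) (m - mone g *+ m \at g)%MM
    else 0
  else 0.

Definition degf x m := deg_fuel (rk top - rk x) x m.

Lemma eq_dsum f f' g n m : (forall m, f m = f' m) -> dsum f g n m = dsum f' g n m.
Proof.
move=> h; elim: n m => [|n IH] m //=; by apply: eq_bigr => i _; apply: IH.
Qed.

Lemma deg_fuelE n n' x m : (rk top - rk x <= n)%N -> (rk top - rk x <= n')%N ->
  deg_fuel n x m = deg_fuel n' x m.
Proof.
elim: n n' x m => [|n IH] [|n'] x m //= hn hn'.
- case: (m == 0%MM) => //; case: (min_supp m) => // g.
  case: ifP => // /negbFE /llt_rk hg; have := lrk_le (lle_top L g); lia.
- case: (m == 0%MM) => //; case: (min_supp m) => // g.
  case: ifP => // /negbFE /llt_rk hg; have := lrk_le (lle_top L g); lia.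
case: (m == 0%MM) => //; case: (min_supp m) => // g.
case: ifP => // /negbFE /llt_rk hg; case: ifP => // _; case: ifP => // _.
by congr (_ * _); apply: eq_dsum => m'; apply: IH; have := lrk_le (lle_top L g); lia.
Qed.

Lemma min_suppP m g : min_supp m = Some g ->
  (0 < m \at g)%N /\ forall h, (0 < m \at h)%N -> le g h.
Proof.
rewrite /min_supp; case: pickP => // g' /andP[h1 /forallP h2] [<-]; split=> // h hm.
exact: (implyP (h2 h)).
Qed.

Lemma min_supp_unique m g : (0 < m \at g)%N -> (forall h, (0 < m \at h)%N -> le g h) ->
  min_supp m = Some g.
Proof.
move=> h1 h2; rewrite /min_supp; case: pickP => [g' /andP[h1' /forallP h2']|/(_ g)].
  congr Some; apply: (@lle_anti _ L); last exact: h2.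
  exact: (implyP (h2' g)).
by rewrite h1 => /negbT/forallPn[h]; rewrite negb_imply => /andP[/h2 ->].
Qed.

Lemma degf_out x m h : (0 < m \at h)%N -> ~~ lt x h -> degf x m = 0.
Proof.
move=> hm hx; have m0 : (m == 0%MM) = false.
  by apply/eqP => e; move: hm; rewrite e mnm0E.
have key g : min_supp m = Some g -> lt x g = false.
  case/min_suppP=> _ hg; apply/negbTE; apply: contra hx => hxg.
  exact: llt_le_trans hxg (hg _ hm).
rewrite /degf; case: (rk top - rk x)%N => [|n] /=; rewrite m0;
  by case: (min_supp m) key => // g /(_ g erefl) ->.
Qed.

Lemma degf0 x : degf x 0%MM = (-1) ^+ (rk top - rk x).-1 * ((rk top - rk x).-1 == 0%N)%:R.
Proof. by rewrite /degf; case: {1}(rk top - rk x)%N => [|n] /=; rewrite eqxx. Qed.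

Lemma degf_top x d : x != top ->
  degf x (mone top *+ d)%MM = (-1) ^+ (rk top - rk x).-1 * (d == (rk top - rk x).-1)%:R.
Proof.
case: d => [|d] nx; first by rewrite mulm0n degf0 eq_sym.
have [n en] : exists n, (rk top - rk x = n.+1)%N.
  by exists (rk top - rk x).-1; have := llt_rk (llt_top nx); lia.
rewrite /degf {1}en /=.
case: eqP => [/mnmP/(_ (enum_rank top))|_]; first by rewrite !at_simpl eqxx.
rewrite (@min_supp_unique _ top); first by rewrite llt_top //= eqxx !at_simpl eqxx mul1n.
  by rewrite !at_simpl eqxx.
by move=> h; rewrite !at_simpl; case: eqP => // <- _; rewrite lle_refl.
Qed.

Lemma degf_chain x g d m : lt x g -> g != top -> (0 < d)%N -> supp_above g m ->
  degf x (mone g *+ d + m)%MM =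
    if (rk g - rk x <= d)%N then
      (-1) ^+ d.-1 * 'C(d.-1, (rk g - rk x).-1)%:R * dsum (degf g) g (d - (rk g - rk x)) m
    else 0.
Proof.
move=> hg ng d0 hm; have [n en] : exists n, (rk top - rk x = n.+1)%N.
  by exists (rk top - rk x).-1; have := llt_rk (llt_top (llt_neq_top hg)); lia.
have mg : m \at g = 0%N.
  by apply/eqP; rewrite -leqn0 leqNgt; apply/negP => /hm; rewrite /llt eqxx andbF.
have E : (mone g *+ d + m)%MM \at g = d by rewrite !at_simpl eqxx mg mul1n addn0.
rewrite /degf {1}en /=; case: eqP => [e|_]; first by move: E d0; rewrite e mnm0E => <-.
rewrite (@min_supp_unique _ g); first last.
- move=> h; rewrite !at_simpl; case: eqP => [<- _|_]; first by rewrite lle_refl.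
  by rewrite mul0n add0n => /hm/llt_le.
- by rewrite E.
rewrite hg /= (negPf ng) E; case: ifP => // _; congr (_ * _).
have -> : (mone g *+ d + m - mone g *+ d)%MM = m.
  by apply: mnm_eq_at => h; rewrite !at_simpl; lia.
apply: eq_dsum => m'; apply: deg_fuelE => //.
by have := llt_rk hg; have := lrk_le (lle_top L g); lia.
Qed.

Lemma supp_above_sub g x m : lt x g -> supp_above g m -> supp_above x m.
Proof. by move=> hx hm h /hm; apply: llt_trans. Qed.

Lemma supp_aboveD g m m' : supp_above g m -> supp_above g m' -> supp_above g (m + m')%MM.
Proof.
move=> hm hm' h; rewrite mnmDE addn_gt0 => /orP[/hm|/hm'] //.
Qed.

Lemma supp_above_mone g h d : lt g h -> supp_above g (mone h *+ d)%MM.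
Proof. by move=> hg h'; rewrite !at_simpl; case: eqP => // <-. Qed.

Lemma supp_above_mone1 g h : lt g h -> supp_above g (mone h).
Proof. by move=> hg h'; rewrite !at_simpl; case: eqP => // <-. Qed.

Lemma supp_above_top m : supp_above top m -> m = 0%MM.
Proof.
move=> hm; apply: mnm_eq_at => h; rewrite mnm0E; apply/eqP; rewrite -leqn0 leqNgt.
by apply/negP => /hm; rewrite top_llt.
Qed.

Lemma min_supp_split m g : min_supp m = Some g ->
  exists d m', [/\ (0 < d)%N, supp_above g m' & m = (mone g *+ d + m')%MM].
Proof.
case/min_suppP=> mg hg; exists (m \at g), (m - mone g *+ m \at g)%MM; split=> //.
  move=> h; rewrite !at_simpl; case: (eqVneq g h) => [<-|ngh]; first by rewrite mul1n subnn.
  by rewrite mul0n subn0 => hh; rewrite /llt ngh hg.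
apply: mnm_eq_at => h; rewrite !at_simpl; case: (eqVneq g h) => [<-|ngh] /=; lia.
Qed.

Lemma supp_decomp m :
  [\/ m = 0%MM,
      exists h h', [/\ (0 < m \at h)%N, (0 < m \at h')%N, ~~ le h h' & ~~ le h' h] |
      exists g d m', [/\ (0 < d)%N, supp_above g m' & m = (mone g *+ d + m')%MM]].
Proof.
case: (boolP [exists h, 0 < m \at h]%N) => [/existsP[h0 hh0]|hno]; last first.
  apply: Or31; apply: mnm_eq_at => h; rewrite mnm0E; apply/eqP; rewrite -leqn0 leqNgt.
  by apply: contra hno => hh; apply/existsP; exists h.
have [g gs gmin] := arg_minnP rk (hh0 : (fun h => (0 < m \at h)%N) h0).
case: (boolP [forall h, (0 < m \at h)%N ==> le g h]) => [/forallP hall|]; last first.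
  rewrite negb_forall => /existsP[h]; rewrite negb_imply => /andP[hh ngh].
  apply: Or32; exists g, h; split=> //; apply: contra ngh => hg.
  by have := gmin h hh => /(lrk_eq hg) ->; rewrite lle_refl.
apply: Or33; exists g; apply: min_supp_split; apply: min_supp_unique => // h.
exact/implyP.
Qed.

Lemma dsum_incomparable f g n m h h' :
  (forall m, (0 < m \at h)%N -> (0 < m \at h')%N -> f m = 0) ->
  (0 < m \at h)%N -> (0 < m \at h')%N -> dsum f g n m = 0.
Proof.
move=> hf; elim: n m => [|n IH] m h1 h2 /=; first exact: hf.
by rewrite big1 // => i _; apply: IH; rewrite mnmDE ?addn_gt0 ?h1 ?h2.
Qed.

(** The least element g of the support lies below both h and h' and is neither of them, so both
    survive in the monomial passed to [degf g]. *)
Lemma degf_incomparable x m h h' : (0 < m \at h)%N -> (0 < m \at h')%N ->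
  ~~ le h h' -> ~~ le h' h -> degf x m = 0.
Proof.
move=> h1 h2 n1 n2; move en : (rk top - rk x)%N => n.
elim/ltn_ind: n x en m h1 h2 => n IH x en m h1 h2.
case E : (min_supp m) => [g|]; last first.
  rewrite /degf; case: (rk top - rk x)%N => [|n'] /=;
  (case: eqP => [e|_]; first by move: h1; rewrite e mnm0E); by rewrite E.
have [mg hg] := min_suppP E.
case: (boolP (lt x g)) => [xg|]; last exact: degf_out.
have [d [m' [d0 hm' e]]] := min_supp_split E.
have [etop|ng] := eqVneq g top.
  case/negP: n1; have <- : g = h by apply: (@lle_anti _ L); [exact: hg | rewrite etop lle_top].
  exact: hg.
have not_g k k' : (0 < m \at k)%N -> (0 < m \at k')%N -> ~~ le k k' -> (0 < m' \at k)%N.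
  move=> hk hk' nkk; move: hk; rewrite e !at_simpl; case: eqP => // egk.
  by case/negP: nkk; rewrite -egk; apply: hg.
rewrite e degf_chain //; case: ifP => // _.
rewrite (@dsum_incomparable _ _ _ _ h h') ?mulr0 //; [|exact: not_g h1 h2 n1|exact: not_g h2 h1 n2].
move=> k k1 k2; apply: (IH (rk top - rk g)%N) => //.
by have := llt_rk xg; have := lrk_le (lle_top L g); lia.
Qed.

(** Multiplication by the sum over [Q] commutes with multiplication by tau, so vanishing passes from
    [f] to [dsum f]; [P] is a condition on monomials that persists under multiplication. *)
Lemma dsum_zero f g n m (P : 'X_{1..#|T|} -> Prop) (Q : pred T) :
  (forall m, P m -> \sum_(h | Q h) f (m + mone h)%MM = 0) ->
  (forall m h, P m -> P (m + mone h)%MM) ->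
  P m -> \sum_(h | Q h) dsum f g n (m + mone h)%MM = 0.
Proof.
move=> hf hP; elim: n m => [|n IH] m hm /=; first exact: hf.
rewrite exchange_big big1 //= => i _.
rewrite (eq_bigr (fun h => dsum f g n (m + mone i + mone h)%MM)); first exact/IH/hP.
by move=> h _; rewrite -addmA (addmC (mone h)) addmA.
Qed.

Lemma degf_chain_sum x g d m : lt x g -> g != top -> (0 < d)%N -> supp_above g m ->
  \sum_(h | lt g h) degf x (mone g *+ d + m + mone h)%MM =
    if (rk g - rk x <= d)%N then
      (-1) ^+ d.-1 * 'C(d.-1, (rk g - rk x).-1)%:R * dsum (degf g) g (d - (rk g - rk x)).+1 m
    else 0.
Proof.
move=> hg ng d0 hm.
rewrite (eq_bigr (fun h => if (rk g - rk x <= d)%N then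
      (-1) ^+ d.-1 * 'C(d.-1, (rk g - rk x).-1)%:R *
      dsum (degf g) g (d - (rk g - rk x)) (m + mone h)%MM else 0)).
  by case: ifP => _; [rewrite mulr_sumr | rewrite big1].
move=> h hh; rewrite -addmA degf_chain //.
by apply: supp_aboveD => //; apply: supp_above_mone1.
Qed.

(** Only h = a and h = top contribute, with opposite signs; any other h jumps at least two ranks
    from x with exponent 1. If a is the top, the exponent d+1 differs from c-1 = 0. *)
Lemma degf_cover_top x a d : cov x a ->
  \sum_(h | le a h) degf x (mone top *+ d + mone h)%MM = 0.
Proof.
move=> hxa; have nx := llt_neq_top (cov_llt hxa).
rewrite (bigD1 top) ?lle_top //=.
have -> : (mone top *+ d + mone top)%MM = (mone top *+ d.+1)%MM.
  by apply: mnm_eq_at => h; rewrite !at_simpl; lia.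
rewrite degf_top //.
have other h : le a h -> h != top -> degf x (mone top *+ d + mone h)%MM =
    if (rk h - rk x <= 1)%N then degf h (mone top *+ d)%MM else 0.
  move=> hah nh; have hxh := llt_le_trans (cov_llt hxa) hah.
  have -> : (mone top *+ d + mone h)%MM = (mone h *+ 1 + mone top *+ d)%MM.
    by apply: mnm_eq_at => h'; rewrite !at_simpl; lia.
  rewrite degf_chain //; last exact/supp_above_mone/llt_top.
  case: ifP => // h1; have -> : (rk h - rk x = 1)%N by have := llt_rk hxh; lia.
  by rewrite subnn expr0 bin0 !mul1r.
have [ea|na] := eqVneq a top.
  rewrite big1 ?addr0 => [|h /andP[hah nh]].
    by rewrite (_ : _ == _ = false) ?mulr0 //; rewrite -ea (cov_rk hxa); lia.
  by case/negP: nh; apply/eqP; apply: (@lle_anti _ L); rewrite ?lle_top // -ea.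
rewrite (bigD1 a) /=; last by rewrite lle_refl.
rewrite other ?lle_refl // big1 ?addr0; last first.
  move=> h /andP[/andP[hah nh] nah]; rewrite other //; case: ifP => // h1.
  have h2 : lt a h by rewrite /llt hah eq_sym.
  by have := llt_rk h2; have := cov_rk hxa; lia.
rewrite (cov_rk hxa) (_ : _ <= _ = true)%N; last by lia.
rewrite degf_top // (cov_rk hxa).
have := llt_rk (llt_top na); rewrite (cov_rk hxa) => hlt.
have -> : ((rk top - rk x).-1 = (rk top - (rk x).+1).-1.+1)%N by lia.
by rewrite eqSS exprS mulN1r mulNr addNr.
Qed.

(** Let g be least in the support, with exponent d. If a is not below g, induction at g applies to
    the join; otherwise the terms h > g, h = g and h = a cancel by Pascal's rule. *)
Lemma degf_cover x a m : cov x a -> \sum_(h | le a h) degf x (m + mone h)%MM = 0.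
Proof.
move en : (rk top - rk x)%N => n.
elim/ltn_ind: n x en a m => n IH x en a m hxa.
case: (boolP [forall h, (0 < m \at h)%N ==> lt x h]) => [/forallP hall|]; last first.
  rewrite negb_forall => /existsP[h]; rewrite negb_imply => /andP[hh nxh].
  by rewrite big1 // => i _; apply: degf_out nxh; rewrite mnmDE addn_gt0 hh.
case: (supp_decomp m) => [->|[k [k' [k1 k2 nk1 nk2]]]|[g [d [m' [d0 hm' e]]]]].
- by have := degf_cover_top 0 hxa; rewrite mulm0n.
- rewrite big1 // => i _.
  by apply: (@degf_incomparable _ _ k k') => //; rewrite mnmDE addn_gt0 ?k1 ?k2.
have xg : lt x g by apply: (implyP (hall g)); rewrite e !at_simpl eqxx; lia.
have [etop|ng] := eqVneq g top.
  by subst g; rewrite e (supp_above_top hm') addm0; apply: degf_cover_top.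
have gltn : (rk top - rk g < n)%N.
  by have := llt_rk xg; have := lrk_le (lle_top L g); lia.
subst m; set t := fun h => degf x (mone g *+ d + m' + mone h)%MM.
have t_inc h : ~~ le g h -> ~~ le h g -> t h = 0.
  by move=> n1 n2; apply: degf_incomparable n1 n2; rewrite !at_simpl eqxx; lia.
have t_g : t g = degf x (mone g *+ d.+1 + m')%MM.
  by congr degf; apply: mnm_eq_at => h; rewrite !at_simpl; lia.
have t_lt h : lt x h -> lt h g -> t h =
    if (rk h - rk x <= 1)%N then degf h (mone g *+ d + m')%MM else 0.
  move=> xh hg; have -> : t h = degf x (mone h *+ 1 + (mone g *+ d + m'))%MM.
    by congr degf; apply: mnm_eq_at => h'; rewrite !at_simpl; lia.
  have nh := llt_neq_top hg.
  rewrite degf_chain //; last first.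
    apply: supp_aboveD; [exact: supp_above_mone | exact: supp_above_sub hm'].
  case: ifP => // h1; have -> : (rk h - rk x = 1)%N by have := llt_rk xh; lia.
  by rewrite subnn expr0 bin0 !mul1r.
change (\sum_(h | le a h) t h = 0).
have t_gt := degf_chain_sum xg ng d0 hm'; rewrite -/t in t_gt.
case: (boolP (le a g)) => [ag|nag]; last first.
  (* Every h above a but not above g is incomparable to g; the others are those above the join k,
     which covers g. *)
  have [k hk hkE] := lle_semimod hxa (llt_le xg) nag.
  rewrite (bigID (le g)) /= [X in _ + X]big1 ?addr0; last first.
    by move=> h /andP[ah ngh]; apply: t_inc => //; apply: contra nag; exact: lle_trans.
  rewrite (eq_bigl (le k)) => [|h]; last by rewrite hkE.
  rewrite (eq_bigr (fun h => if (rk g - rk x <= d)%N then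
      (-1) ^+ d.-1 * 'C(d.-1, (rk g - rk x).-1)%:R *
      dsum (degf g) g (d - (rk g - rk x)) (m' + mone h)%MM else 0)); last first.
    move=> h kh; rewrite /t -addmA degf_chain //; apply: supp_aboveD => //.
    by apply: supp_above_mone1; apply: llt_le_trans (cov_llt hk) kh.
  case: (_ <= d)%N; last by rewrite big1.
  rewrite -mulr_sumr (@dsum_zero (degf g) g _ m' (fun=> True)) ?mulr0 // => m _.
  exact: (IH _ gltn g erefl k m hk).
rewrite (bigID (lt g)) /=.
have -> : \sum_(h | le a h && lt g h) t h = \sum_(h | lt g h) t h.
  by apply: eq_bigl => h; apply: andb_idl => /llt_le; exact: lle_trans.
rewrite [X in X + _]t_gt (bigD1 g); last by rewrite ag /llt eqxx andbF.
rewrite t_g degf_chain //.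
set c := (rk g - rk x)%N; set D := dsum (degf g) g; rewrite [d.+1.-1]/=.
have cE := cov_rk hxa.
have [ea|nag] := eqVneq a g.
  rewrite [X in _ + (_ + X)]big1 ?addr0 => [|h /andP[/andP[ah ngh] nh]]; last first.
    by case/negP: ngh; rewrite /llt -ea ah ea eq_sym.
  have -> : c = 1%N by rewrite /c -ea cE; lia.
  rewrite !ltnS leq0n d0 !bin0 !mulr1 subSS subn0.
  have -> : (d - 1).+1 = d by lia.
  by rewrite -{3}(prednK d0) exprS mulN1r mulNr addrN.
have lag : lt a g by rewrite /llt ag.
have hc : (rk g - rk a = c.-1)%N by rewrite /c cE; lia.
have hc2 : (2 <= c)%N by have := llt_rk lag; rewrite /c; lia.
have t_a : t a = if (c.-1 <= d)%N then
    (-1) ^+ d.-1 * 'C(d.-1, c.-1.-1)%:R * D (d - c.-1)%N m' else 0.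
  rewrite t_lt ?(cov_llt hxa) //; have -> : (rk a - rk x <= 1)%N by rewrite cE; lia.
  by rewrite degf_chain // hc.
rewrite (bigD1 a) /=; last by rewrite lle_refl nag andbT; apply/negP => /llt_rk; have := llt_rk lag; lia.
(* An h strictly between a and g has rank jump at least 2 but exponent 1; the remaining h are
   incomparable to g. *)
rewrite t_a [X in _ + (_ + (_ + X))]big1 ?addr0; last first.
  move=> h /andP[/andP[/andP[ah nlgh] nhg] nha].
  case: (boolP (le h g)) => [hg|nhg'].
    rewrite t_lt ?(llt_le_trans (cov_llt hxa) ah) ?/llt ?hg //.
    case: ifP => // h1; have h2 : lt a h by rewrite /llt ah eq_sym.
    by move: h1 (llt_rk h2); rewrite cE; clear; lia.
  apply: t_inc => //; apply: contra nlgh => gh; by rewrite /llt gh eq_sym.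
(* The term for h > g needs c <= d, those for g and a only c <= d+1; where nonzero, all share the
   same [dsum] factor. *)
case: (ltngtP d.+1 c) => hdc.
- by rewrite !ifF ?addr0 //; lia.
- rewrite !ifT; try lia.
  have -> : (d.+1 - c = (d - c).+1)%N by lia.
  have -> : (d - c.-1 = (d - c).+1)%N by lia.
  have [d' ed] : exists d', d = d'.+1 by exists d.-1; lia.
  have [c' ec] : exists c', c = c'.+2 by exists c.-2; lia.
  (* Pascal's rule *)
  rewrite ed ec /= binS natrD exprS; ring.
- rewrite ifF; last by lia.
  rewrite !ifT; try lia.
  have -> : (d.+1 - c = 0)%N by lia.
  have -> : (d - c.-1 = 0)%N by lia.
  have [d' ed] : exists d', d = d'.+1 by exists d.-1; lia.
  by rewrite -hdc ed /= !binn exprS; ring.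
Qed.

(** The recursion peels off elements g below z. While g < z the variable of z stays in the monomial,
    and at g = z the claim is [degf_cover]. *)
Lemma degf_mul_cover x z k m : cov z k -> (0 < m \at z)%N ->
  \sum_(h | le k h) degf x (m + mone h)%MM = 0.
Proof.
move=> hzk; move en : (rk top - rk x)%N => n.
elim/ltn_ind: n x en m => n IH x en m hm.
case: (boolP [forall h, (0 < m \at h)%N ==> lt x h]) => [/forallP hall|]; last first.
  rewrite negb_forall => /existsP[h]; rewrite negb_imply => /andP[hh nxh].
  by rewrite big1 // => i _; apply: degf_out nxh; rewrite mnmDE addn_gt0 hh.
case: (supp_decomp m) => [e|[j [j' [k1 k2 nk1 nk2]]]|[g [d [m' [d0 hm' e]]]]].
- by move: hm; rewrite e mnm0E.
- rewrite big1 // => i _.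
  by apply: (@degf_incomparable _ _ j j') => //; rewrite mnmDE addn_gt0 ?k1 ?k2.
have xg : lt x g by apply: (implyP (hall g)); rewrite e !at_simpl eqxx; lia.
have gz : le g z.
  move: hm; rewrite e !at_simpl; case: eqP => [-> _|_]; first exact: lle_refl.
  by rewrite mul0n => /hm'/llt_le.
have ng : g != top := llt_neq_top (le_llt_trans gz (cov_llt hzk)).
have gltn : (rk top - rk g < n)%N.
  by have := llt_rk xg; have := lrk_le (lle_top L g); lia.
rewrite (eq_bigr (fun h => if (rk g - rk x <= d)%N then
      (-1) ^+ d.-1 * 'C(d.-1, (rk g - rk x).-1)%:R *
      dsum (degf g) g (d - (rk g - rk x)) (m' + mone h)%MM else 0)); last first.
  move=> h kh; rewrite e -addmA degf_chain //; apply: supp_aboveD => //.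
  by apply: supp_above_mone1; apply: le_llt_trans gz (llt_le_trans (cov_llt hzk) kh).
case: (_ <= d)%N; last by rewrite big1.
rewrite -mulr_sumr; have [ez|nz] := eqVneq g z.
  rewrite (@dsum_zero (degf g) g _ m' (fun=> True)) ?mulr0 // => m0 _.
  by apply: degf_cover; rewrite ez.
have hz : (0 < m' \at z)%N.
  by move: hm; rewrite e !at_simpl (negPf nz) mul0n.
rewrite (@dsum_zero (degf g) g _ m' (fun m0 => 0 < m0 \at z)%N) ?mulr0 // => m0.
  by move=> h; exact: IH gltn g erefl m0 h.
by move=> h; rewrite mnmDE addn_gt0 => ->.
Qed.

Definition deg_functional (p : R) : rat := \sum_(m <- msupp p) p@_m * degf bot m.

(** An index set independent of the polynomial makes linearity a termwise matter. *)
Lemma deg_functionalwE n (p : R) : (msize p <= n)%N ->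
  deg_functional p = \sum_(m : 'X_{1..#|T| < n}) p@_m * degf bot m.
Proof.
move=> hp; pose I : subFinType _ := 'X_{1..#|T| < n}.
rewrite /deg_functional (big_mksub I) //=; first last.
  by move=> x /msize_mdeg_lt /leq_trans; apply.
  by rewrite msupp_uniq.
rewrite big_rmcond //= => i /memN_msupp_eq0 ->; by rewrite mul0r.
Qed.

Lemma deg_functionalD p q :
  deg_functional (p + q) = deg_functional p + deg_functional q.
Proof.
pose n := maxn (msize (p + q)) (maxn (msize p) (msize q)).
rewrite !(@deg_functionalwE n) ?leq_max ?leqnn ?orbT // -big_split /=.
by apply: eq_bigr => m _; rewrite mcoeffD mulrDl.
Qed.

Lemma deg_functionalZ (a : rat) p : deg_functional (a *: p) = a * deg_functional p.
Proof.
pose n := maxn (msize (a *: p)) (msize p).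
rewrite !(@deg_functionalwE n) ?leq_max ?leqnn ?orbT // mulr_sumr.
by apply: eq_bigr => m _; rewrite mcoeffZ mulrA.
Qed.

Lemma deg_functional_sum (J : Type) (s : seq J) (P : pred J) F :
  deg_functional (\sum_(i <- s | P i) F i) = \sum_(i <- s | P i) deg_functional (F i).
Proof.
apply: (big_morph deg_functional); first exact: deg_functionalD.
by rewrite /deg_functional msupp0 big_nil.
Qed.

Lemma deg_functionalX m : deg_functional 'X_[m] = degf bot m.
Proof. by rewrite /deg_functional msuppX big_seq1 mcoeffX eqxx mul1r. Qed.

Lemma deg_functional_ideal p : in_ideal (lchow_gens L) p -> deg_functional p = 0.
Proof.
case=> s [hs ->]; rewrite deg_functional_sum big_seq big1 // => -[r g] /hs /= hg.
rewrite [r]mpolyE mulr_suml deg_functional_sum big1 // => m _.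
rewrite -scalerAl deg_functionalZ.
have XE y : X y = 'X_[mone y] by [].
have sE n k : deg_functional ('X_[n] * sigma L k) = \sum_(h | le k h) degf bot (n + mone h)%MM.
  rewrite /sigma mulr_sumr deg_functional_sum; apply: eq_bigr => h _.
  by rewrite XE -mpolyXD deg_functionalX.
suff -> : deg_functional ('X_[m] * g) = 0 by rewrite mulr0.
case: hg => [->|[x [y [nxy nyx ->]]]|[k hk ->]|[x [k [hk ->]]]].
- rewrite XE -mpolyXD deg_functionalX; apply: (@degf_out _ _ bot).
    by rewrite !at_simpl eqxx addn1.
  by rewrite /llt eqxx andbF.
- rewrite !XE -!mpolyXD deg_functionalX; apply: (@degf_incomparable _ _ x y) => //.
    by rewrite !at_simpl eqxx; lia.
  by rewrite !at_simpl eqxx; lia.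
- by rewrite sE; apply: degf_cover.
- rewrite mulrA XE -mpolyXD sE; apply: (degf_mul_cover _ hk).
  by rewrite !at_simpl eqxx; lia.
Qed.

End DegreeFunctional.

(** * Linear independence *)

Section Independence.
Variables (T : finType) (L : llattice T).
Implicit Types (x y z g h k : T) (m e : 'X_{1..#|T|}) (w : word T).
Local Notation le := (lle L).
Local Notation lt := (llt L).
Local Notation rk := (lrk L).
Local Notation cov := (covers (lle L) (lrk L)).
Local Notation bot := (lbot L).
Local Notation top := (ltop L).
Local Notation R := {mpoly rat[#|T|]}.
Local Notation X := (@mvar T).
Local Notation "m \at h" := (fun_of_multinom m (enum_rank h)) (at level 20).

Lemma mnm_addCA (n : nat) : left_commutative (@mnm_add n).
Proof. by move=> m1 m2 m3; rewrite !addmA (addmC m1). Qed.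

Lemma mone_mulD h a b : (mone h *+ a + mone h *+ b)%MM = (mone h *+ (a + b))%MM.
Proof. by apply: mnm_eq_at => h'; rewrite !at_simpl mulnDr. Qed.

Fixpoint wexp w : 'X_{1..#|T|} :=
  if w is p :: w' then (mone p.1 *+ p.2 + wexp w')%MM else 0%MM.

Lemma wmonE w : wmon w = 'X_[wexp w].
Proof.
elim: w => [|p w IH] /=; first by rewrite /wmon big_nil mpolyX0.
by rewrite mpolyXD -IH /wmon big_cons -mpolyXn.
Qed.

Lemma mdeg_wexp w : mdeg (wexp w) = wdeg w.
Proof.
elim: w => [|p w IH] /=; first by rewrite mdeg0.
by rewrite mdegD mdegMn mdeg1 mul1n IH.
Qed.

Lemma heads_uniq x : uniq (heads L x).
Proof.
apply: allpairs_uniq_dep; first exact: enum_uniq.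
  by move=> y _; exact: iota_uniq.
by move=> [y a] [y' a'] _ _ /= [-> ->].
Qed.

Lemma fy_uniq x : uniq (fy L x).
Proof.
move en : (rk top - rk x)%N => n; elim/ltn_ind: n x en => n IH x en.
rewrite fyE cat_uniq; apply/and3P; split.
- by rewrite map_inj_uniq ?iota_uniq // => a b [].
- apply/hasPn => w /allpairsPdep[p [w' [hp hw ->]]].
  apply/mapP => -[b _ [ep _]]; case/headsP: hp; rewrite ep /=; by rewrite eqxx.
- apply: allpairs_uniq_dep; first exact: heads_uniq.
    move=> p /headsP[hp _ _]; apply: (IH (rk top - rk p.1)%N) => //.
    by have := llt_rk hp; have := lrk_le (lle_top L p.1); rewrite -en; move: (rk p.1); lia.
  by move=> [p w] [p' w'] _ _ /= [-> ->].
Qed.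

Lemma fy_supp x w : x != top -> w \in fy L x -> supp_above L x (wexp w).
Proof.
elim: w x => [|p w IH] x nx; first by move=> _ h; rewrite mnm0E.
rewrite fyE mem_cat => /orP[/mapP[b _ [-> ->]]|/allpairsPdep[p' [w' [hp hw [-> ew]]]]] /=.
  by rewrite addm0; apply/supp_above_mone/llt_top.
case/headsP: (hp) => h1 h2 _; apply: supp_aboveD; first exact: supp_above_mone.
by rewrite ew in IH *; apply: supp_above_sub h1 _; apply: IH.
Qed.

Lemma degf_small x g d m : lt x g -> g != top -> (0 < d < rk g - rk x)%N ->
  supp_above L g m -> degf L x (mone g *+ d + m)%MM = 0.
Proof.
by move=> h1 h2 /andP[h3 h4] h5; rewrite degf_chain //; case: leqP h4.
Qed.

Lemma big_fy (V : nmodType) x (F : word T -> V) :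
  \sum_(w <- fy L x) F w = \sum_(b <- iota 0 (rk top - rk x)) F [:: (top, b)] +
     \sum_(p <- heads L x) \sum_(w <- fy L p.1) F (p :: w).
Proof. by rewrite fyE big_cat /= big_map big_allpairs_dep. Qed.

(** Words starting with (g, a) are tested against g^(c-a) e with c = rk g - rk x, which brings the
    exponent of g to exactly c and leaves [degf g]. Triangularity: smaller g first, then larger a;
    the words in the top variable alone come last. *)
Lemma fy_independent x (c : word T -> rat) : x != top ->
  (forall e, \sum_(w <- fy L x) c w * degf L x (wexp w + e)%MM = 0) ->
  forall w, w \in fy L x -> c w = 0.
Proof.
move en : (rk top - rk x)%N => n; elim/ltn_ind: n x en c => n IH x en c nx hc.
have hheads g a w : (g, a) \in heads L x -> w \in fy L g -> c ((g, a) :: w) = 0.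
  move er : (rk g) => r; elim/ltn_ind: r g er a w => r IHr g er a w.
  move em : (rk g - rk x - a)%N => m; elim/ltn_ind: m a em w => m IHm a em w hp.
  case/headsP: (hp) => /= xg ng ha.
  have hca : (0 < rk g - rk x - a < rk g - rk x)%N by clear -ha; lia.
  move: w; apply: (IH (rk top - rk g)%N _ g erefl (fun w => c ((g, a) :: w))) => //.
    by have := llt_rk xg; have := lrk_le (lle_top L g); lia.
  move=> e; case: (boolP [forall h, (0 < e \at h)%N ==> lt g h]) => [/forallP he|]; last first.
    rewrite negb_forall => /existsP[h]; rewrite negb_imply => /andP[hh ngh].
    rewrite big1 // => w _; rewrite (degf_out (h := h)) ?mulr0 //.
    by rewrite mnmDE addn_gt0 hh orbT.
  have {}he : supp_above L g e by move=> h; exact/implyP.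
  (* Besides the words headed by (g, a), each term vanishes by the form of its monomial or by an
     earlier induction step. *)
  have := hc (mone g *+ (rk g - rk x - a) + e)%MM.
  rewrite big_fy big1_seq ?add0r => [|b _]; last first.
    rewrite mnm_addCA degf_small ?mulr0 //.
    by apply: supp_aboveD => //=; rewrite addm0; apply/supp_above_mone/llt_top.
  rewrite (bigD1_seq _ hp (heads_uniq x)) /=.
  rewrite [X in _ + X]big1_seq ?addr0.
    move=> h0; have : (-1) ^+ (rk g - rk x).-1 != 0 :> rat by rewrite expf_neq0.
    move/mulfI; apply; rewrite mulr0 -{}[RHS]h0 mulr_sumr; apply: eq_big_seq => w hw.
    have -> : (mone g *+ a + wexp w + (mone g *+ (rk g - rk x - a) + e))%MM =
      (mone g *+ (rk g - rk x) + (wexp w + e))%MM.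
      by rewrite mnm_addCA !addmA mone_mulD; congr (_ *+ _ + _ + _)%MM; clear -ha; lia.
    rewrite degf_chain //; last 2 first.
    - by clear -ha; lia.
    - by apply: supp_aboveD => //; apply: fy_supp.
    by rewrite leqnn subnn binn mulr1 mulrCA.
  move=> [g1 a1] /andP[np hp1]; rewrite big1_seq // => w /= hw.
  case/headsP: (hp1) => /= xg1 ng1 ha1.
  have [eg|ng1g] := eqVneq g1 g.
    (* For a1 < a the exponent of g stays below c; for a1 > a the coefficient is already known to
       vanish. *)
    subst g1; have [ha1a|ha1a|ea] := ltngtP a1 a; last by case/negP: np; rewrite ea.
    - have -> : (mone g *+ a1 + wexp w + (mone g *+ (rk g - rk x - a) + e))%MM =
        (mone g *+ (a1 + (rk g - rk x - a)) + (wexp w + e))%MM.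
        by rewrite mnm_addCA !addmA mone_mulD; congr (_ *+ _ + _ + _)%MM; exact: addnC.
      rewrite degf_small ?mulr0 //; first by clear -ha1a ha1 ha; lia.
      by apply: supp_aboveD => //; apply: fy_supp.
    - by rewrite (IHm (rk g - rk x - a1)%N) ?mul0r //; lia.
  case: (boolP (le g1 g)) => [g1g|ng1g'].
    rewrite (IHr (rk g1)) ?mul0r // -er; apply: lrk_lt => //; exact: g1g.
  case: (boolP (le g g1)) => [gg1|ngg1].
    have lgg1 : lt g g1 by rewrite /llt gg1 eq_sym.
    rewrite mnm_addCA degf_small ?mulr0 //.
    apply: supp_aboveD => //; apply: supp_aboveD; first exact: supp_above_mone.
    by apply: supp_above_sub lgg1 _; apply: fy_supp.
  rewrite (@degf_incomparable _ L _ _ g1 g) ?mulr0 //.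
    by rewrite !at_simpl eqxx mul1n !addn_gt0; case/andP: ha1 => ->.
  by rewrite !at_simpl eqxx mul1n !addn_gt0; case/andP: hca => ->; rewrite !orbT.
move=> w; rewrite fyE mem_cat => /orP[/mapP[b hb ->]|/allpairsPdep[[g a] [w' [hp hw ->]]]]; last first.
  exact: hheads.
move: hb; rewrite mem_iota add0n => /andP[_ hb].
(* [degf_top] detects only the exponent c-1 of the top variable, which singles out b. *)
have := hc (mone top *+ ((rk top - rk x).-1 - b))%MM.
rewrite big_fy [X in _ + X]big1_seq ?addr0; last first.
  move=> [g a] /= hp; rewrite big1_seq // => w' /= hw'; by rewrite hheads ?mul0r.
rewrite (bigD1_seq b) ?iota_uniq ?mem_iota //= [X in _ + X]big1_seq ?addr0; last first.
  move=> b' /andP[nb hb']; rewrite /= addm0 mone_mulD degf_top //.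
  by rewrite (_ : _ == _ = false) ?mulr0 //; apply/negbTE; move: nb; apply: contra => /eqP; lia.
rewrite /= addm0 mone_mulD degf_top // (_ : _ == _ = true); last by apply/eqP; lia.
by rewrite mulr1 => /eqP; rewrite mulf_eq0 expf_eq0 oppr_eq0 oner_eq0 andbF orbF => /eqP.
Qed.

Definition fy_degree j := [seq w <- fy L bot | wdeg w == j].

Lemma mpolyX_xprod m : exists2 s : seq T, size s = mdeg m & 'X_[m] = xprod s.
Proof.
exists (flatten [seq nseq (m \at h) h | h <- enum T]).
  rewrite size_flatten /shape -map_comp mdegE sumnE big_map big_enum /=.
  rewrite (reindex (@enum_rank T)) /=; last by apply: onW_bij; exact: enum_rank_bij.
  by apply: eq_bigr => h _; rewrite size_nseq.
rewrite /xprod big_flatten big_map big_enum /= mpolyXE_id.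
rewrite (reindex (@enum_rank T)) /=; last by apply: onW_bij; exact: enum_rank_bij.
apply: eq_bigr => h _; rewrite big_nseq.
by elim: (m \at h) => [|n /= <-] //; rewrite exprS.
Qed.

Lemma lchow_graded_dim j : bot != top ->
  quot_graded_dim (lchow_gens L) j (size (fy_degree j)).
Proof.
move=> nbt; set ws := fy_degree j.
exists (fun i : 'I__ => wmon (nth [::] ws i)); split.
- move=> k; rewrite wmonE /is_homog msuppX /= andbT mdeg_wexp.
  by have /allP := filter_all (fun w => wdeg w == j) (fy L bot); apply; exact: mem_nth.
- move=> c hI k.
  have uws : uniq ws by apply: filter_uniq; exact: fy_uniq.
  (* [fy_independent] concerns words of all degrees, so the coefficients are extended by zero. *)
  pose c' w := if insub (index w ws) is Some i then c i else 0.
  have hc' (i : 'I_(size ws)) : c' (nth [::] ws i) = c i by rewrite /c' index_uniq // valK.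
  have c'0 w : w \notin ws -> c' w = 0.
    by move=> nw; rewrite /c' insubF //; apply/negbTE; rewrite index_mem.
  rewrite -hc'; apply: (fy_independent nbt); last first.
    by have := mem_nth [::] (ltn_ord k); rewrite mem_filter => /andP[].
  move=> e; have := deg_functional_ideal (in_idealMl 'X_[e] hI).
  rewrite mulr_sumr deg_functional_sum => h0; rewrite -[RHS]h0 => {h0}.
  rewrite (bigID (fun w => wdeg w == j)) /= [X in _ + X]big1 ?addr0; last first.
    by move=> w nw; rewrite c'0 ?mul0r // mem_filter negb_and nw.
  rewrite -big_filter -/ws (big_nth [::]) big_mkord; apply: eq_bigr => i _.
  by rewrite hc' -scalerAr deg_functionalZ wmonE -mpolyXD deg_functionalX addmC.
- move=> p hp.
  pose Q (q : R) := q \in [seq wmon w | w <- ws].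
  have : span_mod (lchow_gens L) Q p.
    rewrite [p]mpolyE big_seq; apply: span_mod_sum => m hm; apply: span_mod_scale.
    have [s hs ->] := mpolyX_xprod m.
    have hsj : size s = j by rewrite hs; apply/eqP; exact: (allP hp).
    case: (boolP (all (lt bot) s)) => [hall|/allPn[h hin nlt]].
      rewrite -[xprod s]mul1r.
      have := @xprod_span _ L bot 1 s nbt _ hall; rewrite hsj => hspan.
      apply: span_mod_sub (hspan _); last first.
        by move=> k hk; rewrite mul1r; apply: ideal_atom.
      move=> q [w hw [hwd ->]]; apply: span_mod_gen; rewrite /Q mul1r.
      by apply: map_f; rewrite mem_filter hwd eqxx.
    apply: span_mod_ideal; rewrite /xprod (big_rem h) //=; apply: in_idealMr.
    have -> : h = bot.
      by apply/eqP; rewrite eq_sym; move: nlt; rewrite /llt lle_bot /= negbK.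
    exact: ideal_bot.
  case/span_mod_seq; rewrite size_map => c hc; exists c.
  congr (in_ideal _ (_ - _)): hc; apply: eq_bigr => k _.
  by rewrite (nth_map [::]).
Qed.

End Independence.

(** The constant term equals gamma_0, so (1+X)^d occurs and dominates the other summands, of degree
    d-i with i > 0. Hence the degree read off the size is d. *)
Lemma gamma_nonneg_positive d (f : {poly int}) :
  gamma_nonneg d f -> f`_0 = 1 -> gamma_positive f.
Proof.
case=> g _ fE f0.
have g0 : g 0%N = 1%N.
  move: f0; rewrite fE big_ord_recl /= expr0 mulr1 coefD coef_sum big1 ?addr0; last first.
    by move=> i _; rewrite /bump /= add1n exprS mulrCA -!mulrA coefXM.
  by rewrite -horner_coef0 !hornerE ?expr1n ?mulr1 hornerMn hornerE natz => -[].
have sf : size f = d.+1.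
  rewrite fE big_ord_recl /= g0 muln0 subn0 mul1r mul1r.
  have s2 e : size ((1 + 'X) ^+ e : {poly int}) = e.+1.
    have -> : 1 + 'X = 'X - (-1)%:P :> {poly int} by rewrite polyCN opprK addrC.
    exact: size_exp_XsubC.
  rewrite size_polyDl s2 // ltnS; apply: leq_trans (size_sum _ _ _) _.
  apply/bigmax_leqP => i _; rewrite /bump /= add1n -mulrA -polyC_natr mul_polyC.
  apply: leq_trans (size_scale_leq _ _) _.
  apply: leq_trans (size_polyMleq _ _) _.
  by rewrite size_polyXn s2; have := ltn_ord i; lia.
exists (fun i => (g i)%:Z); split; first by move=> i; rewrite lez_nat.
rewrite {1}fE sf /=; apply: eq_bigr => i _; congr (_ * _ * _).
by rewrite -[in RHS]natz rmorph_nat.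
Qed.

(** * Hilbert series *)

Section HilbertPolynomial.
Variables (T : finType) (L : llattice T).
Local Notation rk := (lrk L).
Local Notation bot := (lbot L).
Local Notation top := (ltop L).

Definition hilbert_poly x : {poly int} := \sum_(w <- fy L x) 'X^(wdeg w).

Lemma hilbert_polyE x : hilbert_poly x = qnum (rk top - rk x) +
  \sum_(y | [&& lle L x y, x != y & y != top]) qnum_mid (rk y - rk x) * hilbert_poly y.
Proof.
rewrite /hilbert_poly big_fy; congr (_ + _).
  rewrite /qnum -(big_mkord predT (fun i => 'X^i)) /index_iota subn0.
  by apply: eq_bigr => b _; rewrite /wdeg /= addn0.
rewrite big_allpairs_dep big_enum_cond /=; apply: eq_big => y.
  by rewrite andbT inE /llt andbA.
move=> _; rewrite /qnum_mid -(big_mkord predT (fun i => 'X^(i.+1))) /index_iota subn0.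
rewrite mulr_suml; apply: eq_bigr => a _; rewrite mulr_sumr; apply: eq_bigr => w _.
by rewrite -exprD.
Qed.

Lemma coef_hilbert_poly j : (hilbert_poly bot)`_j = (size (fy_degree L j))%:Z.
Proof.
rewrite /hilbert_poly coef_sum size_filter -sum1_count -natz natr_sum [RHS]big_mkcond /=.
by apply: eq_bigr => w _; rewrite coefXn eq_sym; case: eqP.
Qed.

Lemma hilbert_poly_gamma_positive : bot != top -> gamma_positive (hilbert_poly bot).
Proof.
move=> nbt; apply: (@gamma_nonneg_positive (rk top - rk bot).-1).
  by apply: (recursion_gamma (L := L)) => // x _; exact: hilbert_polyE.
rewrite hilbert_polyE coefD [X in _ + X]coef_sum [X in _ + X]big1 => [|y _]; last first.
  by rewrite coefM big_ord1 /qnum_mid coef_sum big1 ?mul0r // => i _; rewrite coefXn.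
have := llt_rk (llt_top nbt); case: (rk top - rk bot)%N (subn_gt0 (rk bot) (rk top)) => [<-//|n _ _].
rewrite addr0 /qnum coef_sum big_ord_recl coefXn eqxx big1 ?addr0 // => i _.
by rewrite coefXn.
Qed.

End HilbertPolynomial.

(** * Uniqueness and transfer of graded dimensions *)

Section GradedDimension.
Variables (n : nat) (G : {mpoly rat[n]} -> Prop).
Local Notation I := (in_ideal G).

(** Expand the free family b in the spanning family b'. A row vector killed by the coefficient
    matrix is a relation among the b modulo the ideal, so the d rows are independent in dimension
    d'. *)
Lemma quot_graded_dim_leq j d d' :
  quot_graded_dim G j d -> quot_graded_dim G j d' -> (d <= d')%N.
Proof.
move=> [b [bh bfree _]] [b' [_ _ bspan]].
have [A hA] := fin_all_exists (fun k => bspan _ (bh k)).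
pose M := \matrix_(k, l) A k l.
suff : row_free M by move/eqP <-; exact: rank_leq_col.
rewrite -kermx_eq0; apply/negPn/negP => /rowV0Pn[v /sub_kermxP hv /negP[]].
apply/eqP/rowP => k; rewrite mxE; apply: (bfree (v 0)).
have -> : \sum_k v 0 k *: b k =
    \sum_k v 0 k *: (b k - \sum_l A k l *: b' l) + \sum_l (v *m M) 0 l *: b' l.
  have -> : \sum_l (v *m M) 0 l *: b' l = \sum_k v 0 k *: \sum_l A k l *: b' l.
    rewrite (eq_bigr (fun l => \sum_k (v 0 k * A k l) *: b' l)).
      by rewrite exchange_big; apply: eq_bigr => k' _; rewrite scaler_sumr; apply: eq_bigr => l _; rewrite scalerA.
    by move=> l _; rewrite mxE scaler_suml; apply: eq_bigr => k' _; rewrite mxE.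
  by rewrite -big_split; apply: eq_bigr => k' _; rewrite scalerBr /= addrNK.
apply: in_idealD; first by apply: in_ideal_sum => k' _; apply: in_idealZ.
by rewrite hv big1 => [|l _]; [exact: in_ideal0 | rewrite mxE scale0r].
Qed.

Lemma quot_graded_dim_unique j d d' :
  quot_graded_dim G j d -> quot_graded_dim G j d' -> d = d'.
Proof. by move=> h h'; apply/eqP; rewrite eqn_leq !(@quot_graded_dim_leq j). Qed.

Lemma hilbert_series_gamma (h : nat -> nat) (f : {poly int}) :
  hilbert_fun G h -> (forall j, f`_j = (h j)%:Z) -> gamma_positive f ->
  hilbert_series_gamma_positive G.
Proof.
move=> hh hf gf; split; first by exists h.
move=> h' hh'; exists f; split=> // j; rewrite hf.
by rewrite (quot_graded_dim_unique (hh j) (hh' j)).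
Qed.

End GradedDimension.

Section Substitution.
Variables (n m : nat) (phi : 'I_n -> {mpoly rat[m]}).

Definition subst (p : {mpoly rat[n]}) : {mpoly rat[m]} := mmap (@mpolyC m rat) phi p.


Lemma substB p q : subst (p - q) = subst p - subst q. Proof. exact: mmapB. Qed.
Lemma substZ a p : subst (a *: p) = a *: subst p.
Proof. by rewrite /subst mmapZ mul_mpolyC. Qed.
Lemma substM p q : subst (p * q) = subst p * subst q.
Proof. exact: rmorphM. Qed.
Lemma subst1 : subst 1 = 1. Proof. exact: rmorph1. Qed.
Lemma substX i : subst 'X_i = phi i. Proof. by rewrite /subst mmapX mmap1U. Qed.
Lemma subst_sum (J : Type) (s : seq J) (P : pred J) F :
  subst (\sum_(i <- s | P i) F i) = \sum_(i <- s | P i) subst (F i).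
Proof. exact: raddf_sum. Qed.

Lemma subst_monomial k : subst 'X_[k] = \prod_i phi i ^+ k i.
Proof. by rewrite /subst mmapX. Qed.

Lemma subst_ideal G1 G2 p : (forall p, G1 p -> in_ideal G2 (subst p)) ->
  in_ideal G1 p -> in_ideal G2 (subst p).
Proof.
move=> h [s [hs ->]]; rewrite subst_sum big_seq; apply: in_ideal_sum => -[r g] /hs hg.
by rewrite substM; apply: in_idealMl; apply: h.
Qed.

Lemma subst_homog j p : (forall i, phi i \is 1.-homog) -> p \is j.-homog -> subst p \is j.-homog.
Proof.
move=> h /dhomogP hp; rewrite [p]mpolyE subst_sum big_seq; apply: rpred_sum => k hk.
rewrite substZ; apply: dhomogZ; rewrite subst_monomial -(hp _ hk) /= mdegE.
elim/big_rec2: _ => [|i a q _ IH]; first exact: dhomog1.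
by apply: dhomogM => //; have := dhomogMn (k i) (h i); rewrite mul1n.
Qed.

End Substitution.

Lemma subst_comp_id (n m : nat) (G1 : {mpoly rat[n]} -> Prop)
  (phi : 'I_n -> {mpoly rat[m]}) (psi : 'I_m -> {mpoly rat[n]}) p :
  (forall i, in_ideal G1 (subst psi (phi i) - 'X_i)) ->
  in_ideal G1 (subst psi (subst phi p) - p).
Proof.
move=> h.
have hM (a b c d : {mpoly rat[n]}) :
    in_ideal G1 (a - b) -> in_ideal G1 (c - d) -> in_ideal G1 (a * c - b * d).
  move=> h1 h2; have -> : a * c - b * d = c * (a - b) + b * (c - d) by ring.
  by apply: in_idealD; apply: in_idealMl.
rewrite {1 2}[p]mpolyE (subst_sum phi) (subst_sum psi) -sumrB.
apply: in_ideal_sum => k _; rewrite !substZ -scalerBr; apply: in_idealZ.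
rewrite subst_monomial mpolyXE_id.
elim/big_rec2: _ => [|i a b _ IH]; first by rewrite subst1 subrr; exact: in_ideal0.
rewrite substM; apply: (hM) => //.
elim: (k i) => [|e IHe]; first by rewrite subst1 subrr; exact: in_ideal0.
by rewrite !exprS substM; apply: (hM).
Qed.

(** The substitutions induce mutually inverse graded maps of the quotients; [psi] carries the basis
    over. *)
Lemma quot_graded_dim_transfer (n m : nat)
  (G1 : {mpoly rat[n]} -> Prop) (G2 : {mpoly rat[m]} -> Prop)
  (phi : 'I_n -> {mpoly rat[m]}) (psi : 'I_m -> {mpoly rat[n]}) j d :
  (forall p, G1 p -> in_ideal G2 (subst phi p)) ->
  (forall p, G2 p -> in_ideal G1 (subst psi p)) ->
  (forall i, phi i \is 1.-homog) -> (forall i, psi i \is 1.-homog) ->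
  (forall i, in_ideal G1 (subst psi (phi i) - 'X_i)) ->
  (forall i, in_ideal G2 (subst phi (psi i) - 'X_i)) ->
  quot_graded_dim G2 j d -> quot_graded_dim G1 j d.
Proof.
move=> phi_ideal psi_ideal phi_homog psi_homog psiK phiK [b [bh bfree bspan]].
have sumE c : subst psi (\sum_(k < d) c k *: b k) = \sum_(k < d) c k *: subst psi (b k).
  by rewrite subst_sum; apply: eq_bigr => k _; rewrite substZ.
exists (fun k => subst psi (b k)); split.
- by move=> k; apply: subst_homog => //; exact: bh.
- move=> c; rewrite -sumE => /(subst_ideal phi_ideal) hI; apply: bfree.
  rewrite -[X in in_ideal _ X](subKr (subst phi (subst psi (\sum_(k < d) c k *: b k)))).
  by apply: in_idealB => //; apply: subst_comp_id.
- move=> p hp; have [c hc] := bspan _ (subst_homog phi_homog hp); exists c.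
  have := subst_ideal psi_ideal hc; rewrite substB sumE => hI.
  have -> : p - \sum_(k < d) c k *: subst psi (b k) =
     (subst psi (subst phi p) - \sum_(k < d) c k *: subst psi (b k))
     - (subst psi (subst phi p) - p) by ring.
  by apply: in_idealB => //; apply: subst_comp_id.
Qed.

(** Used for labels: z \ x is the union of y \ x and z \ y, so its first element is the earlier of
    the two first ones. *)
Lemma find_or (A : Type) (a b : pred A) s :
  find (fun x => a x || b x) s = minn (find a s) (find b s).
Proof. by elim: s => //= x s ->; case: (a x); case: (b x) => //=; rewrite ?minnSS ?min0n ?minn0. Qed.

(** * Lattices of flats *)

Section FlatLattice.
Variables (E : finType) (M : matroid E).
Implicit Types (A B F G H K S : {set E}) (e i : E).
Local Notation r := (mrank M).

Lemma mrank_set0 : r set0 = 0%N.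
Proof. by apply/eqP; rewrite -leqn0 -(cards0 E); exact: mrank_card. Qed.

Lemma mrank_add1 A e : (r (e |: A) <= (r A).+1)%N.
Proof.
have := mrank_submod M [set e] A; have := mrank_card M [set e]; rewrite cards1; lia.
Qed.

Definition cl A : {set E} := [set e | r (e |: A) == r A].

Lemma sub_cl A : A \subset cl A.
Proof. by apply/subsetP => e eA; rewrite inE (setUidPr _) ?sub1set. Qed.

(** Elements of the closure are added one at a time; submodularity shows that none of them raises
    the rank. *)
Lemma mrank_cl_sub A S : S \subset cl A -> r (A :|: S) = r A.
Proof.
move en : #|S| => n; elim: n S en => [|n IH] S en hS.
  by move/eqP: en; rewrite cards_eq0 => /eqP ->; rewrite setU0.
have [e eS] : exists e, e \in S by apply/card_gt0P; rewrite en.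
have hc : #|S :\ e| = n by move: en; rewrite (cardsD1 e) eS => -[].
have hs : S :\ e \subset cl A by apply: subset_trans hS; exact: subsetDl.
have h1 := IH _ hc hs.
have he : r (e |: A) = r A by move/subsetP: hS => /(_ e eS); rewrite inE => /eqP.
have := mrank_submod M (A :|: (S :\ e)) (e |: A).
have -> : A :|: S :\ e :|: (e |: A) = A :|: S.
  apply/setP => x; rewrite !inE; case: eqP => [->|_] /=; rewrite ?eS ?orbT //.
  by case: (x \in A); case: (x \in S).
have := @mrank_mono _ M A ((A :|: S :\ e) :&: (e |: A)) _.
rewrite subsetI subsetUl subsetUr => /(_ isT).
have := @mrank_mono _ M A (A :|: S) (subsetUl _ _); lia.
Qed.

Lemma mrank_cl A : r (cl A) = r A.
Proof. by rewrite -(mrank_cl_sub (subxx (cl A))) (setUidPr (sub_cl A)). Qed.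

Lemma flatP F : reflect (forall e, e \notin F -> r F < r (e |: F))%N (flat M F).
Proof. by apply: (iffP forallP) => h e; have := h e; [move/implyP | move=> h1; exact/implyP]. Qed.

Lemma flat_cl A : flat M (cl A).
Proof.
apply/flatP => e; rewrite inE mrank_cl => he.
have h1 : (r A < r (e |: A))%N.
  by rewrite ltn_neqAle eq_sym he; apply: mrank_mono; exact: subsetUr.
by apply: leq_trans h1 _; apply: mrank_mono; apply: setUS; exact: sub_cl.
Qed.

Lemma cl_min A F : flat M F -> A \subset F -> cl A \subset F.
Proof.
move=> /flatP hF AF; apply/subsetP => e; rewrite inE => /eqP he; apply/negPn/negP => /hF.
have := mrank_submod M F (e |: A).
have -> : F :|: (e |: A) = e |: F by rewrite setUCA (setUidPl AF).
have : (r A <= r (F :&: (e |: A)))%N by apply: mrank_mono; rewrite subsetI AF subsetUr.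
lia.
Qed.

Lemma flat_rank_lt F G : flat M F -> F \subset G -> F != G -> (r F < r G)%N.
Proof.
move=> /flatP hF FG nFG.
have [e eG eF] : exists2 e, e \in G & e \notin F.
  by apply/subsetPn; apply: contra nFG => GF; rewrite eqEsubset FG.
by apply: leq_trans (hF e eF) _; apply: mrank_mono; rewrite subUset sub1set eG.
Qed.

Lemma rank_cl_add1 F e : flat M F -> e \notin F -> r (cl (e |: F)) = (r F).+1.
Proof.
by move=> /flatP hF /hF h; rewrite mrank_cl; have := mrank_add1 F e; lia.
Qed.

Definition flat_type := {F : {set E} | flat M F}.
Implicit Types (x y z a h k : flat_type).

Definition flat_of A : flat_type := Sub (cl A) (flat_cl A).
Definition flat_le x y := val x \subset val y.
Definition flat_rk x := r (val x).
(** The ground set is ordered by [enum E], and an element is represented by its position there. *)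
Definition flat_lab x y := find (mem (val y :\: val x)) (enum E).

Lemma flat_lab_sub x y : flat_le x y -> x != y ->
  exists e, [/\ e \in val y, e \notin val x, flat_lab x y = index e (enum E) &
    forall z, flat_le x z -> flat_le z y -> e \in val z -> flat_lab x z = flat_lab x y].
Proof.
move=> xy nxy.
have hh : has (mem (val y :\: val x)) (enum E).
  have : ~~ (val y \subset val x).
    by apply: contra nxy => yx; rewrite -val_eqE eqEsubset yx andbT.
  case/subsetPn => e ey ex; apply/hasP; exists e; rewrite ?mem_enum //.
  by rewrite !inE ex.
have [e0 _ _] := hasP hh.
exists (nth e0 (enum E) (flat_lab x y)).
have := nth_find e0 hh; rewrite -/(flat_lab x y) /= !inE => /andP[ex ey].
split=> //; first by rewrite index_uniq ?enum_uniq // -has_find.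
move=> z xz zy ez; apply/eqP; rewrite eqn_leq; apply/andP; split.
  rewrite leqNgt; apply/negP => /(before_find e0) /=.
  by rewrite !inE ex ez.
apply: sub_find => i /=; rewrite !inE => /andP[-> iz] /=; exact: (subsetP zy).
Qed.

Lemma flat_cover_eq x k e : covers flat_le flat_rk x k -> e \in val k -> e \notin val x ->
  k = flat_of (e |: val x).
Proof.
move=> /andP[xk /eqP hk] ek ex; apply/val_inj/eqP; rewrite eq_sym.
have hsub : cl (e |: val x) \subset val k.
  by apply: cl_min (valP k) _; rewrite subUset sub1set ek.
apply/negPn/negP => hn; have := flat_rank_lt (flat_cl _) hsub hn.
by rewrite (rank_cl_add1 (valP x) ex) -hk ltnn.
Qed.

Lemma flat_of_cover x e : e \notin val x -> covers flat_le flat_rk x (flat_of (e |: val x)).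
Proof.
move=> ex; rewrite /covers /flat_rk /= (rank_cl_add1 (valP x) ex) eqxx andbT.
by apply: subset_trans (sub_cl _); exact: subsetUr.
Qed.

Lemma flat_of_le x z e : flat_le (flat_of (e |: val x)) z = (e \in val z) && flat_le x z.
Proof.
apply/idP/andP => [h|[ez xz]]; last by apply: cl_min (valP z) _; rewrite subUset sub1set ez.
have := subset_trans (sub_cl _) h; rewrite subUset sub1set => /andP[]; by split.
Qed.

Hypothesis Mloopless : loopless M.

Lemma flat_set0 : flat M set0.
Proof. by apply/flatP => e _; rewrite mrank_set0 setU0 Mloopless. Qed.

Lemma flat_setT : flat M setT.
Proof. by apply/flatP => e; rewrite inE. Qed.

Definition flat_bot : flat_type := Sub set0 flat_set0.
Definition flat_top : flat_type := Sub setT flat_setT.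

Lemma flat_lab_split x y z : flat_le x y -> x != y -> flat_le y z -> y != z ->
  flat_lab x y != flat_lab y z /\ flat_lab x z = minn (flat_lab x y) (flat_lab y z).
Proof.
move=> xy nxy yz nyz.
have [e [ey ex le _]] := flat_lab_sub xy nxy; have [f [fz fy lf _]] := flat_lab_sub yz nyz.
split; last first.
  rewrite /flat_lab -find_or; apply: eq_find => i /=; rewrite !inE.
  case: (boolP (i \in val x)) => [ix|ix]; first by rewrite (subsetP xy _ ix).
  by case: (boolP (i \in val y)) => [iy|]; rewrite // (subsetP yz _ iy).
rewrite le lf; apply/eqP => ei; have : e = f.
  by rewrite -(nth_index e (mem_enum E e)) ei nth_index // mem_enum.
by move=> ef; move: fy; rewrite -ef ey.
Qed.

Lemma flat_lab_cover x y : flat_le x y -> x != y ->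
  exists k, [/\ covers flat_le flat_rk x k, flat_le k y, flat_lab x k = flat_lab x y &
    forall k', covers flat_le flat_rk x k' -> flat_le k' y ->
      flat_lab x k' = flat_lab x y -> k' = k].
Proof.
move=> xy nxy; have [e [ey ex le hle]] := flat_lab_sub xy nxy.
have ky : flat_le (flat_of (e |: val x)) y by rewrite flat_of_le ey.
have hk := flat_of_cover ex.
exists (flat_of (e |: val x)); split=> //.
  apply: hle => //; first by case/andP: hk.
  by apply: (subsetP (sub_cl _)); rewrite !inE eqxx.
move=> k' hk' k'y lk'; apply: flat_cover_eq => //.
have xk' : flat_le x k' by case/andP: hk'.
have nxk' : x != k'.
  by apply/eqP => exk'; move: hk'; rewrite /covers -exk' => /andP[_ /eqP]; lia.
have [f [fk _ lf _]] := flat_lab_sub xk' nxk'.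
suff -> : e = f by [].
by rewrite -(nth_index e (mem_enum E e)) -le -lk' lf nth_index // mem_enum.
Qed.

(** For e in a but not in h, a is spanned by x and e, so the flat spanned by h and e is the join of
    a and h. *)
Lemma flat_semimod x a h : covers flat_le flat_rk x a -> flat_le x h -> ~~ flat_le a h ->
  exists2 k, covers flat_le flat_rk h k & forall z, flat_le k z = flat_le a z && flat_le h z.
Proof.
move=> xa xh /subsetPn[e ea eh].
have ex : e \notin val x by apply: contra eh; exact: (subsetP xh).
exists (flat_of (e |: val h)); first exact: flat_of_cover.
move=> z; rewrite flat_of_le (flat_cover_eq xa ea ex) flat_of_le.
case: (boolP (flat_le h z)) => [hz|]; rewrite ?andbF // !andbT.
by have -> : flat_le x z := subset_trans xh hz; rewrite andbT.
Qed.

Definition flat_llattice : llattice flat_type.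
Proof.
apply: (@LLattice _ flat_le flat_bot flat_top flat_rk flat_lab).
- by move=> x; exact: subxx.
- by move=> x y xy yx; apply/val_inj/eqP; rewrite eqEsubset; apply/andP; split.
- by move=> y x z; exact: subset_trans.
- by move=> x; exact: sub0set.
- by move=> x; exact: subsetT.
- by move=> x y xy nxy; apply: flat_rank_lt (valP x) xy _; rewrite val_eqE.
- exact: flat_lab_split.
- exact: flat_lab_cover.
- exact: flat_semimod.
Defined.

End FlatLattice.

(** * Adjoining a new bottom element *)

Section AddBottom.
Variables (T : finType) (L : llattice T).
Implicit Types u v : option T.

Definition opt_le u v :=
  match u, v with None, _ => true | Some _, None => false | Some x, Some y => lle L x y end.
(** The rank of the old bottom is subtracted so that it becomes 1 and the old bottom covers the new
    one. *)
Definition opt_rk u := if u is Some x then (lrk L x - lrk L (lbot L)).+1 else 0%N.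
(** Old labels move up by one, and 0 labels every step from the new bottom, whose only cover is the
    old bottom. *)
Definition opt_lab u v := match u, v with Some x, Some y => (lab L x y).+1 | _, _ => 0%N end.

Lemma opt_covers x y : covers opt_le opt_rk (Some x) (Some y) = covers (lle L) (lrk L) x y.
Proof.
rewrite /covers /=; case: (boolP (lle L x y)) => //= xy.
by have := lrk_le (lle_bot L x); have := lrk_le xy; rewrite eqSS => *; apply/eqP/eqP; lia.
Qed.

Definition opt_llattice : llattice (option T).
Proof.
apply: (@LLattice _ opt_le None (Some (ltop L)) opt_rk opt_lab).
- by case=> //= x; exact: lle_refl.
- by move=> [x|] [y|] //= xy yx; rewrite (lle_anti xy yx).
- by move=> [y|] [x|] [z|] //=; exact: lle_trans.
- by case.
- by case=> //= x; exact: lle_top.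
- move=> [x|] [y|] //= xy nxy; have := lrk_lt xy nxy.
  by have := lrk_le (lle_bot L x); rewrite ltnS; lia.
- move=> [x|] [y|] [z|] //= xy nxy yz nyz.
    have [h1 h2] := lab_split xy nxy yz nyz.
    by rewrite h2 -minnSS eqSS.
- move=> [x|] [y|] //= xy nxy.
    have [k [h1 h2 h3 h4]] := lab_cover xy nxy.
    exists (Some k); split=> //=; rewrite ?opt_covers ?h3 //.
    by move=> [k'|] //; rewrite opt_covers => c1 c2 [c3]; rewrite (h4 k').
  exists (Some (lbot L)); split=> //=; first by rewrite /covers /= subnn.
    exact: lle_bot.
  move=> [k|] //; rewrite /covers /= => /eqP[hk] _ _; congr Some.
  by apply/esym/(lrk_eq (lle_bot L k)); lia.
- move=> [x|] [a|] [h|] //=; rewrite ?opt_covers.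
  + move=> xa xh nah; have [k hk hkE] := lle_semimod xa xh nah.
    by exists (Some k); rewrite ?opt_covers // => -[z|] //=.
  + rewrite /covers /= => /eqP[ha] _; have -> : a = lbot L.
      by apply/esym/(lrk_eq (lle_bot L a)); lia.
    by rewrite lle_bot.
  + by move=> ca _ _; exists (Some a) => // -[z|] //=; rewrite andbT.
Defined.

End AddBottom.

(** * The two presentations *)

Section VarSubst.
Variables (V : finType) (m : nat) (phi : V -> {mpoly rat[m]}).

Definition vsubst (p : {mpoly rat[#|V|]}) : {mpoly rat[m]} :=
  subst (fun i => phi (enum_val i)) p.

Lemma vsubst_mvar v : vsubst (mvar v) = phi v.
Proof. by rewrite /vsubst /mvar substX enum_rankK. Qed.
Lemma vsubstB p q : vsubst (p - q) = vsubst p - vsubst q. Proof. exact: substB. Qed.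
Lemma vsubst0 : vsubst 0 = 0. Proof. by rewrite -[0]subr0 vsubstB subrr. Qed.
Lemma vsubstN p : vsubst (- p) = - vsubst p.
Proof. by rewrite -[- p]add0r vsubstB vsubst0 add0r. Qed.
Lemma vsubstM p q : vsubst (p * q) = vsubst p * vsubst q. Proof. exact: substM. Qed.
Lemma vsubst_sum (J : Type) (s : seq J) (P : pred J) F :
  vsubst (\sum_(i <- s | P i) F i) = \sum_(i <- s | P i) vsubst (F i).
Proof. exact: subst_sum. Qed.
Lemma vsubst_sum_mvar (J : finType) (P : pred J) (F : J -> V) :
  vsubst (\sum_(i | P i) mvar (F i)) = \sum_(i | P i) phi (F i).
Proof. by rewrite vsubst_sum; apply: eq_bigr => i _; rewrite vsubst_mvar. Qed.

End VarSubst.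

Lemma mvar_homog (V : finType) (v : V) : mvar v \is 1.-homog.
Proof. by rewrite dhomogX /= mdeg1. Qed.

(** A graded isomorphism with the ring of a labelled lattice suffices, as the Hilbert function there
    is known. *)
Lemma lchow_transfer (V T : finType) (L : llattice T) (G : {mpoly rat[#|V|]} -> Prop)
  (phi : V -> {mpoly rat[#|T|]}) (psi : T -> {mpoly rat[#|V|]}) :
  lbot L != ltop L ->
  (forall p, G p -> in_ideal (lchow_gens L) (vsubst phi p)) ->
  (forall p, lchow_gens L p -> in_ideal G (vsubst psi p)) ->
  (forall v, phi v \is 1.-homog) -> (forall x, psi x \is 1.-homog) ->
  (forall v, in_ideal G (vsubst psi (phi v) - mvar v)) ->
  (forall x, in_ideal (lchow_gens L) (vsubst phi (psi x) - mvar x)) ->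
  hilbert_series_gamma_positive G.
Proof.
move=> nbt h1 h2 h3 h4 h5 h6.
apply: (hilbert_series_gamma (h := fun j => size (fy_degree L j)) _ (coef_hilbert_poly L)).
  move=> j; apply: (quot_graded_dim_transfer (phi := fun i => phi (enum_val i))
    (psi := fun i => psi (enum_val i)) h1 h2 _ _ _ _ (lchow_graded_dim j nbt)) => // i.
    by have := h5 (enum_val i); rewrite /mvar enum_valK.
  by have := h6 (enum_val i); rewrite /mvar enum_valK.
exact: hilbert_poly_gamma_positive.
Qed.

Section Matroid.
Variables (E : finType) (M : matroid E) (hM : loopless M).
Local Notation FT := (flat_type M).
Local Notation L := (flat_llattice hM).
Implicit Types (x y z h k : FT) (i : E).

(** A cover of x is spanned by x and one element i, which turns sigma_k into a sum over the flats
    above x that contain i. *)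
Lemma flat_cover_elem x k : covers (lle L) (lrk L) x k ->
  exists2 i, i \notin val x & forall z, flat_le k z = (i \in val z) && flat_le x z.
Proof.
move=> hxk; have [hle hrk] := andP hxk.
have : ~~ (val k \subset val x).
  apply/negP => kx; have e : x = k by apply: (@lle_anti _ L).
  by move: hrk; rewrite e; lia.
case/subsetPn => i ik ix; exists i => // z.
by rewrite (flat_cover_eq hxk ik ix) flat_of_le.
Qed.

Section Reduced.
Variable i0 : E.
Local Notation RV := (redVar M).
Local Notation X := (@mvar FT).
Local Notation I := (in_ideal (lchow_gens L)).
Local Notation J := (in_ideal (@redChow_gens E M)).

Lemma red_flatP (v : RV) : flat M (val v).
Proof. by case/andP: (valP v) => /andP[]. Qed.

Definition red_flat (v : RV) : FT := Sub (val v) (red_flatP v).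

(** The top variable, absent from the presentation of the reduced Chow ring, is
    minus the sum of the variables of the flats through a fixed element. *)
Definition red_psi x : {mpoly rat[#|{: RV}|]} :=
  if insub (val x) is Some v then mvar v
  else if val x == setT then - \sum_(v : RV | i0 \in val v) mvar v else 0.

Lemma red_cases x : [\/ x = flat_bot hM, x = flat_top M | exists v, x = red_flat v].
Proof.
have [e0|n0] := eqVneq (val x) set0; first by apply: Or31; apply: val_inj.
have [eT|nT] := eqVneq (val x) setT; first by apply: Or32; apply: val_inj.
have hx : flat M (val x) && (val x != set0) && (val x != setT) by rewrite (valP x) n0.
by apply: Or33; exists (Sub (val x) hx); apply: val_inj.
Qed.

Lemma red_psi_flat v : red_psi (red_flat v) = mvar v.
Proof. by rewrite /red_psi /= valK. Qed.

Lemma red_psi_bot : red_psi (flat_bot hM) = 0.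
Proof.
rewrite /red_psi insubF /=; last by rewrite eqxx andbF.
by case: eqP => // /setP/(_ i0); rewrite !inE.
Qed.

Lemma red_psi_top : red_psi (flat_top M) = - \sum_(v : RV | i0 \in val v) mvar v.
Proof. by rewrite /red_psi insubF /= ?eqxx // andbF. Qed.

Lemma sum_flat_red (W : nmodType) i (f : FT -> W) :
  \sum_(x : FT | i \in val x) f x = \sum_(v : RV | i \in val v) f (red_flat v) + f (flat_top M).
Proof.
rewrite (bigD1 (flat_top M)) ?inE //= addrC; congr (_ + _).
rewrite (reindex_omap red_flat (fun x => insub (val x))) /=.
  apply: eq_bigl => v; rewrite valK eqxx andbT; apply: andb_idr => _.
  by case/andP: (valP v) => _; apply: contra => /eqP/(congr1 val) /= ->.
move=> x /andP[ix nx]; case: (red_cases x) => [ex|ex|[v ->]].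
- by move: ix; rewrite ex inE.
- by rewrite ex eqxx in nx.
- by rewrite /= valK.
Qed.

Lemma red_psi_incomparable x y : ~~ flat_le x y -> ~~ flat_le y x ->
  J (red_psi x * red_psi y).
Proof.
case: (red_cases x) => [->|->|[v ->]]; rewrite ?red_psi_bot ?red_psi_flat.
- by rewrite /flat_le sub0set.
- by rewrite /flat_le subsetT.
case: (red_cases y) => [->|->|[w ->]]; rewrite ?red_psi_flat.
- by rewrite /flat_le sub0set.
- by rewrite /flat_le subsetT.
move=> nvw nwv; apply: in_ideal_gen; left; exists v, w; split=> //.
by rewrite /incomparable; apply/andP.
Qed.

Lemma red_psi_sum i : J (\sum_(x : FT | i \in val x) red_psi x).
Proof.
rewrite sum_flat_red red_psi_top (eq_bigr _ (fun v _ => red_psi_flat v)).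
by apply: in_ideal_gen; right; exists i, i0.
Qed.

Lemma flat_atom i : I (\sum_(x : FT | i \in val x) X x).
Proof.
have hi : i \notin val (flat_bot hM) by rewrite inE.
have := ideal_atom (L := L) (flat_of_cover hi); congr (in_ideal _ _).
by apply: eq_bigl => x; rewrite [lle _ _ _]flat_of_le /flat_le sub0set andbT.
Qed.

Lemma reduced_gamma_positive : hilbert_series_gamma_positive (@redChow_gens E M).
Proof.
apply: (@lchow_transfer RV FT L _ (fun v => X (red_flat v)) red_psi).
- by apply/eqP => /(congr1 val)/setP/(_ i0); rewrite !inE.
- move=> p [[v [w [/andP[nvw nwv] ->]]]|[i [j ->]]].
    by rewrite vsubstM !vsubst_mvar; apply: ideal_incomparable.
  (* The sums over all flats through i and through j lie in the ideal; in their difference the top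
     variable cancels. *)
  rewrite vsubstB !(vsubst_sum_mvar (fun v => X (red_flat v))).
  have := in_idealB (flat_atom i) (flat_atom j).
  by rewrite !(sum_flat_red _ X) opprD addrACA subrr addr0.
- move=> p [->|[x [y [nxy nyx ->]]]|[k hk ->]|[x [k [hk ->]]]].
  + by rewrite vsubst_mvar red_psi_bot; exact: in_ideal0.
  + by rewrite vsubstM !vsubst_mvar; apply: red_psi_incomparable.
  + have [i _ hi] := flat_cover_elem hk; rewrite (vsubst_sum_mvar red_psi).
    rewrite (eq_bigl (fun x : FT => i \in val x)); first exact: red_psi_sum.
    by move=> x; rewrite [lle _ _ _]hi /flat_le sub0set andbT.
  (* The flats through i that are not above x are incomparable to x, since i lies outside x, so they
     may be added to the sum. *)
  + have [i ix hi] := flat_cover_elem hk.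
    rewrite vsubstM vsubst_mvar (vsubst_sum_mvar red_psi) (eq_bigl _ _ hi).
    have := in_idealMl (red_psi x) (red_psi_sum i).
    rewrite (bigID (flat_le x)) /= mulrDr => hJ.
    rewrite -[X in in_ideal _ X](addrK (red_psi x * \sum_(y : FT | (i \in val y) && ~~ flat_le x y) red_psi y)).
    apply: in_idealB => //; rewrite mulr_sumr; apply: in_ideal_sum => y /andP[iy nxy].
    apply: red_psi_incomparable => //.
    by apply: contra ix => /subsetP; apply.
- by move=> v; exact: mvar_homog.
- move=> x; case: (red_cases x) => [->|->|[v ->]].
  + by rewrite red_psi_bot dhomog0.
  + by rewrite red_psi_top rpredN rpred_sum // => v _; exact: mvar_homog.
  + by rewrite red_psi_flat mvar_homog.
- by move=> v; rewrite vsubst_mvar red_psi_flat subrr; exact: in_ideal0.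
- move=> x; case: (red_cases x) => [->|->|[v ->]].
  + by rewrite red_psi_bot vsubst0 sub0r; apply: in_idealN; exact: ideal_bot.
  + rewrite red_psi_top vsubstN (vsubst_sum_mvar (fun v => X (red_flat v))) -opprD.
    by apply: in_idealN; rewrite -(sum_flat_red i0 X); exact: flat_atom.
  + by rewrite red_psi_flat vsubst_mvar subrr; exact: in_ideal0.
Qed.

End Reduced.

Local Notation L1 := (opt_llattice L).
Local Notation X := (@mvar (option FT)).
Local Notation I := (in_ideal (lchow_gens L1)).

Lemma sum_option (T : finType) (W : nmodType) (P : pred (option T)) (f : option T -> W) :
  ~~ P None -> \sum_(u | P u) f u = \sum_(j : T | P (Some j)) f (Some j).
Proof.
move=> nP; rewrite (reindex_omap Some id) /=; last by case=> // h; rewrite h in nP.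
by apply: eq_bigl => x; rewrite eqxx andbT.
Qed.

Lemma opt_sigma x : sigma L1 (Some x) = \sum_(y | flat_le x y) X (Some y).
Proof. by rewrite /sigma sum_option. Qed.

Lemma opt_bot_cover u : covers (lle L1) (lrk L1) None u = (u == Some (flat_bot hM)).
Proof.
case: u => [x|] //; rewrite /covers /= eqSS.
apply/eqP/eqP => [h|[->]]; last by rewrite subnn.
congr Some; apply/esym; apply: (@lrk_eq _ L); first exact: lle_bot.
by move: h => /=; lia.
Qed.

Lemma opt_total : I (\sum_x X (Some x)).
Proof.
have := @ideal_atom _ L1 (Some (flat_bot hM)).
rewrite opt_bot_cover eqxx opt_sigma => /(_ isT); congr (in_ideal _ _).
by apply: eq_bigl => x; rewrite /flat_le sub0set.
Qed.

(** Over an empty ground set the lattice of flats is a point, and the reduced Chow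
    ring is compared with the lattice with a new bottom element instead. *)
Lemma reduced_gamma_positive_empty : (forall i : E, False) ->
  hilbert_series_gamma_positive (@redChow_gens E M).
Proof.
move=> noE.
have noV (v : redVar M) : False.
  have /andP[/andP[_ /set0Pn[i _]] _] := valP v; exact: noE i.
have psi0 (T : finType) (p : {mpoly rat[#|T|]}) (u : T) : vsubst (fun=> 0 : {mpoly rat[#|redVar M|]}) (mvar u * p) = 0.
  by rewrite vsubstM vsubst_mvar mul0r.
apply: (@lchow_transfer (redVar M) (option FT) L1 _ (fun=> 0) (fun=> 0)).
- by [].
- by move=> p [[v]|[i]]; [case: (noV v) | case: (noE i)].
- move=> p [->|[x [y [_ _ ->]]]|[k _ ->]|[x [k [_ ->]]]].
  + by rewrite vsubst_mvar; exact: in_ideal0.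
  + by rewrite psi0; exact: in_ideal0.
  + by rewrite vsubst_sum_mvar big1 //; exact: in_ideal0.
  + by rewrite psi0; exact: in_ideal0.
- by move=> v; case: (noV v).
- by move=> u; exact: dhomog0.
- by move=> v; case: (noV v).
move=> u; rewrite vsubst0 sub0r; apply: in_idealN.
case: u => [x|]; last exact: (ideal_bot L1).
have ex y : y = x by apply/val_inj/setP => i; case: (noE i).
by have := opt_total; rewrite (big_pred1 x) // => y; apply/esym/eqP; exact: ex.
Qed.

Section Augmented.
Local Notation FV := (flatVar M).
Local Notation AV := (augVar M).
Local Notation J := (in_ideal (@augChow_gens E M)).
Local Notation xa := (@xa E M).
Local Notation ya := (@ya E M).

Lemma aug_flatP (v : FV) : flat M (val v).
Proof. by case/andP: (valP v). Qed.

Definition aug_flat (v : FV) : FT := Sub (val v) (aug_flatP v).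

(** As all x_F add up to 0, the sum over flats avoiding i, which presents y_i, is minus the sum over
    flats through i. In this form the relation y_i x_F = 0 becomes a cover relation. *)
Definition aug_phi (a : AV) : {mpoly rat[#|{: option FT}|]} :=
  match a with
  | inl v => X (Some (aug_flat v))
  | inr i => - \sum_(x : FT | i \in val x) X (Some x)
  end.

(** The variables [x_F] of all flats, including the empty one and [E], add up to
    0 since the empty flat is the only cover of the new bottom element. *)
Definition aug_psi_flat x : {mpoly rat[#|{: AV}|]} :=
  if insub (val x) is Some v then xa v else - \sum_v xa v.

Definition aug_psi (u : option FT) := if u is Some x then aug_psi_flat x else 0.

Lemma aug_cases x : x = flat_top M \/ exists v, x = aug_flat v.
Proof.
have [eT|nT] := eqVneq (val x) setT; first by left; apply: val_inj.
have hx : flat M (val x) && (val x != setT) by rewrite (valP x) nT.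
by right; exists (Sub (val x) hx); apply: val_inj.
Qed.

Lemma aug_psi_flatE v : aug_psi_flat (aug_flat v) = xa v.
Proof. by rewrite /aug_psi_flat /= valK. Qed.

Lemma aug_psi_top : aug_psi_flat (flat_top M) = - \sum_v xa v.
Proof. by rewrite /aug_psi_flat insubF //= eqxx andbF. Qed.

Lemma sum_flat_aug (W : nmodType) (P : pred {set E}) (f : FT -> W) :
  \sum_(x : FT | P (val x)) f x =
  \sum_(v : FV | P (val v)) f (aug_flat v) + (if P setT then f (flat_top M) else 0).
Proof.
rewrite (bigID (fun x => x == flat_top M)) /= addrC; congr (_ + _).
  rewrite (reindex_omap aug_flat (fun x => insub (val x))) /=.
    apply: eq_bigl => v; rewrite valK eqxx andbT; apply: andb_idr => _.
    by case/andP: (valP v) => _; apply: contra => /eqP/(congr1 val) /= ->.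
  move=> x /andP[_ nx]; case: (aug_cases x) => [ex|[v ->]]; last by rewrite /= valK.
  by rewrite ex eqxx in nx.
case: ifP => hP; last first.
  by rewrite big_pred0 // => x; apply/andP => -[hx /eqP ex]; move: hx; rewrite ex /= hP.
by rewrite (big_pred1 (flat_top M)) // => x; apply/andP/eqP => [[_ /eqP]|->] //.
Qed.

Lemma xa_incomparable x y : ~~ flat_le x y -> ~~ flat_le y x ->
  J (aug_psi_flat x * aug_psi_flat y).
Proof.
case: (aug_cases x) => [->|[v ->]]; first by rewrite {2}/flat_le subsetT.
case: (aug_cases y) => [->|[w ->]]; first by rewrite /flat_le subsetT.
rewrite !aug_psi_flatE => nvw nwv; apply: in_ideal_gen; right; left; exists v, w; split=> //.
by rewrite /incomparable; apply/andP.
Qed.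

Lemma aug_psi_sum i :
  \sum_(x : FT | i \in val x) aug_psi_flat x = - \sum_(v : FV | i \notin val v) xa v.
Proof.
rewrite (sum_flat_aug (fun F => i \in F)) inE aug_psi_top (eq_bigr _ (fun v _ => aug_psi_flatE v)).
by rewrite [X in _ - X](bigID (fun v : FV => i \in val v)) /= opprD addrA subrr add0r.
Qed.

Lemma ya_relation i : J (ya i - \sum_(v : FV | i \notin val v) xa v).
Proof. by apply: in_ideal_gen; left; exists i. Qed.

Lemma augmented_gamma_positive : hilbert_series_gamma_positive (@augChow_gens E M).
Proof.
apply: (@lchow_transfer AV (option FT) L1 _ aug_phi aug_psi) => //.
- move=> p [[i ->]|[[v [w [/andP[nvw nwv] ->]]]|[i [v [iv ->]]]]].
  + rewrite vsubstB vsubst_mvar /= (vsubst_sum_mvar aug_phi) /=.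
    rewrite -opprD; apply: in_idealN; have := opt_total; congr (in_ideal _ _).
    rewrite (bigID (fun x : FT => i \in val x)) /=; congr (_ + _).
    by rewrite (sum_flat_aug (fun F => i \notin F)) inE addr0.
  + by rewrite vsubstM !vsubst_mvar; apply: ideal_incomparable.
  + rewrite vsubstM !vsubst_mvar /= mulNr; apply: in_idealN; rewrite mulrC.
    (* Flats through i above F form sigma of the cover of F spanned by i; the others are
       incomparable to F. *)
    rewrite (bigID (flat_le (aug_flat v))) /= mulrDr; apply: in_idealD.
      have := @ideal_cover _ L1 (Some (aug_flat v)) (Some (flat_of M (i |: val v))).
      rewrite opt_covers opt_sigma => /(_ (flat_of_cover _)) h.
      have := h iv; congr (in_ideal _ (_ * _)); apply: eq_bigl => x.
      by rewrite (flat_of_le (aug_flat v)).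
    rewrite mulr_sumr; apply: in_ideal_sum => x /andP[ix nvx].
    apply: ideal_incomparable => //=; apply: contra iv => /subsetP; exact.
- move=> p [->|[[x|] [[y|] [nxy nyx ->]]]|[k hk ->]|[[x|] [[k|] [hk ->]]]] //.
  + by rewrite vsubst_mvar; exact: in_ideal0.
  + by rewrite vsubstM !vsubst_mvar; apply: xa_incomparable.
  + move: hk; rewrite opt_bot_cover => /eqP ->; rewrite opt_sigma (vsubst_sum_mvar aug_psi) /=.
    rewrite (eq_bigl (fun x : FT => predT (val x))); last by move=> x; rewrite /flat_le sub0set.
    rewrite (sum_flat_aug predT) /= aug_psi_top (eq_bigr _ (fun v _ => aug_psi_flatE v)).
    by rewrite subrr; exact: in_ideal0.
  + move: hk; rewrite opt_covers => hk; have [i ix hi] := flat_cover_elem hk.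
    rewrite vsubstM vsubst_mvar opt_sigma (vsubst_sum_mvar aug_psi) (eq_bigl _ _ hi) /=.
    case: (aug_cases x) hk ix hi => [->|[v ->]] hk ix hi; first by rewrite inE in ix.
    have inc : J (aug_psi_flat (aug_flat v) *
        \sum_(y : FT | (i \in val y) && ~~ flat_le (aug_flat v) y) aug_psi_flat y).
      rewrite mulr_sumr; apply: in_ideal_sum => y /andP[iy nxy].
      by apply: xa_incomparable => //; apply: contra ix => /subsetP; apply.
    (* By [aug_psi_sum] the sum is -y_i modulo the ideal, and y_i x_F is a generator because i lies
       outside F. *)
    have tot : J (aug_psi_flat (aug_flat v) * \sum_(y : FT | i \in val y) aug_psi_flat y).
      rewrite aug_psi_sum aug_psi_flatE.
      have -> : xa v * - (\sum_(w : FV | i \notin val w) xa w) =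
        xa v * (ya i - \sum_(w : FV | i \notin val w) xa w) - ya i * xa v by ring.
      apply: in_idealB; first by apply: in_idealMl; exact: ya_relation.
      by apply: in_ideal_gen; right; right; exists i, v.
    by have := in_idealB tot inc; rewrite -mulrBr [X in X - _](bigID (flat_le (aug_flat v))) /= addrK.
  + by rewrite vsubstM vsubst_mvar /= mul0r; exact: in_ideal0.
- case=> [v|i]; first exact: mvar_homog.
  by rewrite /= rpredN rpred_sum // => x _; exact: mvar_homog.
- case=> [x|]; last exact: dhomog0.
  case: (aug_cases x) => [->|[v ->]] /=; last by rewrite aug_psi_flatE mvar_homog.
  by rewrite aug_psi_top rpredN rpred_sum // => v _; exact: mvar_homog.
- case=> [v|i] /=.
    by rewrite vsubst_mvar /= aug_psi_flatE subrr; exact: in_ideal0.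
  rewrite vsubstN (vsubst_sum_mvar aug_psi) /= aug_psi_sum opprK -opprB.
  by apply: in_idealN; exact: ya_relation.
- case=> [x|] /=; last first.
    by rewrite vsubst0 sub0r; apply: in_idealN; exact: (ideal_bot L1).
  case: (aug_cases x) => [->|[v ->]] /=; last first.
    by rewrite aug_psi_flatE vsubst_mvar /= subrr; exact: in_ideal0.
  rewrite aug_psi_top vsubstN (vsubst_sum_mvar aug_phi) /= -opprD; apply: in_idealN.
  have := opt_total; congr (in_ideal _ _).
  by rewrite (sum_flat_aug predT).
Qed.

End Augmented.
End Matroid.

Theorem theorem3p25 (E : finType) (M : matroid E) :
  loopless M ->
  hilbert_series_gamma_positive (@redChow_gens E M) /\
  hilbert_series_gamma_positive (@augChow_gens E M).
Proof.
move=> hM; split; last exact: augmented_gamma_positive.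
case: (pickP (fun _ : E => true)) => [i0 _|noE]; first exact: reduced_gamma_positive i0.
by apply: reduced_gamma_positive_empty => // i; have := noE i.
Qed.
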